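(* Let $R$ be a commutative ring, let $n \in \mathbb{N}$, and let $\Lambda = M_{n\times n}(R)$. For a finitely presented $\Lambda$-module $M$ put $\mathrm{Fit}_{\Lambda}(M) := \mathrm{Fit}_{R}(e_{11}M)$. Let $M$, $M_1$, $M_2$, $M_3$ be finitely presented $\Lambda$-modules. Then: (i) For any $1 \le i \le n$, we have $\mathrm{Fit}_{\Lambda}(M) = \mathrm{Fit}_{R}(e_{ii}M)$. (ii) $\mathrm{Fit}_{\Lambda}(M) \subset \mathrm{Ann}_{R}(M)$. (iii) If $M_1 \twoheadrightarrow M_2$ is an epimorphism, then $\mathrm{Fit}_{\Lambda}(M_1) \subset \mathrm{Fit}_{\Lambda}(M_2)$. (iv) If $M_2 = M_1 \oplus M_3$, then $\mathrm{Fit}_{\Lambda}(M_2) = \mathrm{Fit}_{\Lambda}(M_1)\cdot \mathrm{Fit}_{\Lambda}(M_3)$. (v) If $M_1 \xrightarrow{\iota} M_2 \twoheadrightarrow M_3$ is an exact sequence ($\iota$ need not be injective), then $\mathrm{Fit}_{\Lambda}(M_1)\cdot \mathrm{Fit}_{\Lambda}(M_3) \subset \mathrm{Fit}_{\Lambda}(M_2)$. (vi) If $M_1 \hookrightarrow M_2 \twoheadrightarrow M_3$ is a (short) exact sequence and $M_3$ has a quadratic presentation (i.e. one of the form $\Lambda^k \to \Lambda^k \twoheadrightarrow M_3$ for some $k \in \mathbb{N}$), then $\mathrm{Fit}_{\Lambda}(M_1)\cdot \mathrm{Fit}_{\Lambda}(M_3) = \mathrm{Fit}_{\Lambda}(M_2)$.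 (vii) For any map $R \to S$ of commutative rings, $\mathrm{Fit}_{S\otimes_R \Lambda}(S \otimes_R M) = S\cdot \mathrm{Fit}_{\Lambda}(M)$. (viii) $\mathrm{Fit}_{R}(M) = \mathrm{Fit}_{\Lambda}(M)^{n}$. (ix) If $I$ is a finitely generated two-sided ideal of $\Lambda$, then $I = M_{n\times n}(J)$ for some ideal $J$ of $R$, and so $\Lambda/I = M_{n\times n}(R/J)$; hence $\mathrm{Fit}_{\Lambda}(\Lambda/I) = J^{n}$.
   Context: All rings have an identity and all modules are left modules. $e_{ij} \in \Lambda = M_{n\times n}(R)$ denotes the matrix with $1$ in position $(i,j)$ and $0$ elsewhere. For a $\Lambda$-module $M$, $e_{ii}M$ is regarded as an $R$-module. For a commutative ring $R$ and a finitely presented $R$-module $N$ with presentation $R^a \xrightarrow{h} R^b \twoheadrightarrow N$, $h$ identified with an $a\times b$ matrix, $\mathrm{Fit}_R(N)$ is the usual (zeroth) Fitting ideal: the ideal of $R$ generated by all $b\times b$ minors of $h$ if $a \ge b$, and $0$ if $a<b$ (independent of the presentation). In (vii), $S\otimes_R\Lambda$ is identified with $M_{n\times n}(S)$ and $S\cdot \mathrm{Fit}_\Lambda(M)$ is the ideal of $S$ generated by the image of $\mathrm{Fit}_\Lambda(M)$. In (viii), $M$ is regarded as an $R$-module via the scalar embedding $R \to \Lambda$. *)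

(* Defs.v *)
From HB Require Import structures.
From mathcomp Require Import all_boot all_order all_algebra.
From mathcomp Require Import boolp classical_sets.

Set Implicit Arguments.
Unset Strict Implicit.
Unset Printing Implicit Defensive.

Import GRing.Theory.
Local Open Scope classical_set_scope.
Local Open Scope ring_scope.
Local Open Scope quotient_scope.

(** ** Ideals and quotient rings *)

(* Two-sided ideals; over a commutative ring these are the usual ideals. *)
Definition is_ideal (A : pzRingType) (I : set A) : Prop :=
  [/\ I 0, forall x y, I x -> I y -> I (x + y)
    & forall a x, I x -> I (a * x) /\ I (x * a)].

Definition ideal_gen (A : pzRingType) (X : set A) : set A :=
  smallest (@is_ideal A) X.

Definition ideal_mul (A : pzRingType) (I J : set A) : set A :=
  ideal_gen [set z | exists x y, [/\ I x, J y & z = x * y]].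

Definition ideal_exp (A : pzRingType) (I : set A) (k : nat) : set A :=
  iter k (ideal_mul I) setT.

Record ideal (A : pzRingType) := Ideal {
  ideal_set :> set A;
  idealP : is_ideal ideal_set
}.

Definition fg_ideal (A : pzRingType) (I : ideal A) : Prop :=
  exists s : seq A, (I : set A) = ideal_gen [set x | x \in s].

Definition ideal_mx (R : pzRingType) (n : nat) (J : set R) : set 'M[R]_n :=
  [set A | forall i j, J (A i j)].

Definition in_ideal (A : pzRingType) (I : ideal A) : pred A :=
  fun x => `[< ideal_set I x >].

Lemma in_ideal_zmod_closed (A : pzRingType) (I : ideal A) :
  zmod_closed (in_ideal I).
Proof.
have [I0 ID IM] := idealP I.
split=> [|x y /asboolP Ix /asboolP Iy]; first exact/asboolP.
by apply/asboolP/ID => //; rewrite -mulN1r; apply: (IM _ _ Iy).1.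
Qed.

HB.instance Definition _ (A : pzRingType) (I : ideal A) :=
  GRing.isZmodClosed.Build A (in_ideal I) (in_ideal_zmod_closed I).

(* MathComp's [{ideal_quot _}] requires a proper ideal of a nonzero commutative
   ring, so only its quotient of additive groups can be reused here. *)
Definition quot_ring (A : pzRingType) (I : ideal A) : Type :=
  Quotient.quot (GRing.ZmodClosed.clone A (in_ideal I) _).

Section QuotientRing.
Variables (A : pzRingType) (I : ideal A).
Local Notation Q := (quot_ring I).

HB.instance Definition _ := GRing.Zmodule.on Q.

Definition quot_class (x : A) : Q :=
  \pi_(Quotient.quot (GRing.ZmodClosed.clone A (in_ideal I) _)) x.

Lemma quot_classD x y : quot_class (x + y) = quot_class x + quot_class y.
Proof. by rewrite /quot_class raddfD. Qed.

Lemma quot_class_eq x y : quot_class x = quot_class y <-> (I : set A) (x - y).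
Proof.
rewrite /quot_class; split=> [/eqP|H].
  by rewrite -Quotient.idealrBE => /asboolP.
by apply/eqP; rewrite -Quotient.idealrBE; apply/asboolP.
Qed.

Lemma quot_classK (q : Q) : quot_class (repr q) = q.
Proof. exact: reprK. Qed.

Definition quot_one : Q := quot_class 1.
Definition quot_mul (p q : Q) : Q := quot_class (repr p * repr q).

Lemma quot_classM x y :
  quot_class (x * y) = quot_mul (quot_class x) (quot_class y).
Proof.
have [I0 ID IM] := idealP I.
apply/quot_class_eq; set x' := repr _; set y' := repr _.
have Ix : (I : set A) (x - x') by apply/quot_class_eq; rewrite quot_classK.
have Iy : (I : set A) (y - y') by apply/quot_class_eq; rewrite quot_classK.
have -> : x * y - x' * y' = (x - x') * y + x' * (y - y').
  by rewrite mulrBl mulrBr addrA subrK.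
by apply: ID; [apply: (IM _ _ Ix).2 | apply: (IM _ _ Iy).1].
Qed.

Lemma quot_mulA : associative quot_mul.
Proof.
move=> p q r; rewrite -[p]quot_classK -[q]quot_classK -[r]quot_classK.
by rewrite -!quot_classM mulrA.
Qed.

Lemma quot_mul1l : left_id quot_one quot_mul.
Proof. by move=> p; rewrite -[p]quot_classK -quot_classM mul1r. Qed.

Lemma quot_mul1r : right_id quot_one quot_mul.
Proof. by move=> p; rewrite -[p]quot_classK -quot_classM mulr1. Qed.

Lemma quot_mulDl : left_distributive quot_mul +%R.
Proof.
move=> p q r; rewrite -[p]quot_classK -[q]quot_classK -[r]quot_classK.
by rewrite -!(quot_classD, quot_classM) mulrDl.
Qed.

Lemma quot_mulDr : right_distributive quot_mul +%R.
Proof.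
move=> p q r; rewrite -[p]quot_classK -[q]quot_classK -[r]quot_classK.
by rewrite -!(quot_classD, quot_classM) mulrDr.
Qed.

HB.instance Definition _ := GRing.Zmodule_isPzRing.Build Q
  quot_mulA quot_mul1l quot_mul1r quot_mulDl quot_mulDr.

Definition quot_scale (a : A) (q : Q) : Q := quot_class a * q.

Lemma quot_scaleA a b q : quot_scale a (quot_scale b q) = quot_scale (a * b) q.
Proof. by rewrite /quot_scale quot_classM mulrA. Qed.

Lemma quot_scale1 : left_id 1 quot_scale.
Proof. by move=> q; rewrite /quot_scale mul1r. Qed.

Lemma quot_scaleDr : right_distributive quot_scale +%R.
Proof. by move=> a p q; rewrite /quot_scale mulrDr. Qed.

Lemma quot_scaleDl q : {morph quot_scale^~ q : a b / a + b}.
Proof. by move=> a b; rewrite /quot_scale quot_classD mulrDl. Qed.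

HB.instance Definition _ := GRing.Zmodule_isLmodule.Build A Q
  quot_scaleA quot_scale1 quot_scaleDr quot_scaleDl.

End QuotientRing.

(** ** Finite presentations and Fitting ideals *)

(* Linear maps A^a -> A^b of left modules are right multiplications of row
   vectors by a x b matrices, as for [h] below. *)
Definition presents (A : pzRingType) (M : lmodType A) (a b : nat)
    (h : 'M[A]_(a, b)) : Prop :=
  exists p : {linear 'rV[A]_b -> M},
    (forall y, exists x, p x = y) /\
    (forall x, p x = 0 <-> exists z : 'rV[A]_a, x = z *m h).

Definition finitely_presented (A : pzRingType) (M : lmodType A) : Prop :=
  exists a b (h : 'M[A]_(a, b)), presents M h.

Definition has_quadratic_presentation (A : pzRingType) (M : lmodType A) : Prop :=
  exists k (h : 'M[A]_k), presents M h.

(* If a < b there is no increasing f : 'I_b -> 'I_a, and this is the zero ideal. *)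
Definition minors_ideal (R : comPzRingType) (a b : nat) (h : 'M[R]_(a, b)) :
    set R :=
  ideal_gen [set d | exists f : 'I_b -> 'I_a,
    {homo f : i j / (i < j)%N} /\ d = \det (rowsub f h)].

(* [get] picks the ideal of one presentation; all presentations give the same
   ideal. The value is irrelevant if N is not finitely presented. *)
Definition Fit (R : comPzRingType) (N : lmodType R) : set R :=
  get [set I | exists a b (h : 'M[R]_(a, b)), presents N h /\ I = minors_ideal h].

Definition annihilator (R : pzRingType) (M : lmodType R) : set R :=
  [set r | forall x : M, r *: x = 0].

(** ** Modules over matrix rings as modules over the base ring *)

Definition scalar_restr (R : comPzRingType) (n : nat) (M : lmodType 'M[R]_n) :
  Type := M.

Section ScalarRestriction.
Variables (R : comPzRingType) (n : nat) (M : lmodType 'M[R]_n).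
Local Notation N := (scalar_restr M).

HB.instance Definition _ := GRing.Zmodule.on N.

Definition scalar_restr_scale (r : R) (x : N) : N := (r%:M : 'M[R]_n) *: (x : M).

Lemma scalar_restr_scaleA r s x :
  scalar_restr_scale r (scalar_restr_scale s x) = scalar_restr_scale (r * s) x.
Proof. by rewrite /scalar_restr_scale scalerA scalar_mxM. Qed.

Lemma scalar_restr_scale1 : left_id 1 scalar_restr_scale.
Proof. by move=> x; apply: (@scale1r _ M). Qed.

Lemma scalar_restr_scaleDr : right_distributive scalar_restr_scale +%R.
Proof. by move=> r x y; apply: (@scalerDr _ M). Qed.

Lemma scalar_restr_scaleDl x :
  {morph scalar_restr_scale^~ x : r s / r + s}.
Proof. by move=> r s; rewrite /scalar_restr_scale raddfD scalerDl. Qed.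

HB.instance Definition _ := GRing.Zmodule_isLmodule.Build R N
  scalar_restr_scaleA scalar_restr_scale1 scalar_restr_scaleDr
  scalar_restr_scaleDl.

Lemma scalar_restr_scaleC (A : 'M[R]_n) (r : R) (x : M) :
  A *: (r *: (x : N) : M) = r *: (A *: x : N).
Proof.
change (A *: ((r%:M : 'M[R]_n) *: x) = (r%:M : 'M[R]_n) *: (A *: x)).
by rewrite !scalerA; congr (_ *: _); exact/scalar_mxC.
Qed.

(* The R-module e_ii M. *)
Definition in_corner (i : 'I_n) : pred N :=
  fun x => `[< exists y : M, x = delta_mx i i *: y >].

Lemma in_corner_submod_closed i : submod_closed (in_corner i).
Proof.
split=> [|r x y /asboolP[u ->] /asboolP[v ->]]; apply/asboolP.
  by exists 0; rewrite scaler0.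
exists ((r%:M : 'M[R]_n) *: u + v); rewrite scalerDr; congr (_ + _).
by rewrite -[LHS]scalar_restr_scaleC.
Qed.

HB.instance Definition _ i := GRing.isSubmodClosed.Build R N (in_corner i)
  (in_corner_submod_closed i).

Record corner (i : 'I_n) := Corner {
  corner_val :> N;
  corner_valP : corner_val \in in_corner i
}.

HB.instance Definition _ i := [isSub for @corner_val i].
HB.instance Definition _ i := [Choice of corner i by <:].
HB.instance Definition _ i := [SubChoice_isSubLmodule of corner i by <:].

End ScalarRestriction.

Arguments corner {R n} M i.

(* e_11 is the matrix unit of index [ord0]. *)
Definition FitMx (R : comPzRingType) (n : nat) (M : lmodType 'M[R]_n.+1) : set R :=
  Fit (corner M ord0).

(** ** Extension of scalars *)

(* S is an R-algebra via f. The tensor product S ⊗_R N is the set of formal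
   sums of pure tensors, two of them being identified when all R-balanced
   biadditive maps take the same value on them; see [tensor_universal]. *)

Definition balanced (R S : comPzRingType) (f : {rmorphism R -> S})
    (N : lmodType R) (P : zmodType) (b : S -> N -> P) : Prop :=
  [/\ forall s t x, b (s + t) x = b s x + b t x,
      forall s x y, b s (x + y) = b s x + b s y
    & forall s r x, b (s * f r) x = b s (r *: x)].

Section Tensor.
Variables (R S : comPzRingType) (f : {rmorphism R -> S}) (N : lmodType R).

Definition tsum (P : zmodType) (b : S -> N -> P) (u : seq (S * N)) : P :=
  \sum_(p <- u) b p.1 p.2.

Lemma eq_tsum (P : zmodType) (b c : S -> N -> P) u :
  (forall s x, b s x = c s x) -> tsum b u = tsum c u.
Proof. by move=> bc; apply: eq_bigr => p _. Qed.

Definition tensor_rel (u v : seq (S * N)) : bool :=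
  `[< forall (P : zmodType) (b : S -> N -> P), balanced f b ->
        tsum b u = tsum b v >].

Lemma tensor_relP : equiv_class_of tensor_rel.
Proof.
split=> [u|u v|v u w].
- exact/asboolP.
- by apply/asboolP/asboolP => H P b bP; rewrite H.
- by move=> /asboolP H1 /asboolP H2; apply/asboolP => P b bP; rewrite H1 ?H2.
Qed.

Canonical tensor_equiv := EquivRelPack tensor_relP.
Canonical tensor_encModRel := defaultEncModRel tensor_rel.

Definition tensor : Type := {eq_quot tensor_rel}.

HB.instance Definition _ := Choice.on tensor.

Definition tclass (u : seq (S * N)) : tensor := \pi_({eq_quot tensor_rel}) u.

Lemma tclassP u v :
  (forall (P : zmodType) (b : S -> N -> P), balanced f b ->
     tsum b u = tsum b v) <-> tclass u = tclass v.
Proof.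
rewrite /tclass; split=> [H|/eqP].
  by apply/eqP; rewrite eqmodE; apply/asboolP.
by rewrite eqmodE => /asboolP.
Qed.

Lemma tclassK q : tclass (repr q) = q.
Proof. exact: reprK. Qed.

(* A map on formal sums induced by an operation on pure tensors. *)
Lemma tclass_flatten (g : S * N -> seq (S * N)) :
  (forall (P : zmodType) (b : S -> N -> P), balanced f b ->
     balanced f (fun s x => tsum b (g (s, x)))) ->
  forall u v, tclass u = tclass v ->
    tclass (flatten (map g u)) = tclass (flatten (map g v)).
Proof.
move=> gP u v /tclassP uv; apply/tclassP => P b bP.
have E w : tsum b (flatten (map g w)) = tsum (fun s x => tsum b (g (s, x))) w.
  rewrite /tsum big_flatten big_map; apply: eq_bigr => -[s x] _ //.
by rewrite !E uv //; apply: gP.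
Qed.

Definition tadd (p q : tensor) : tensor := tclass (repr p ++ repr q).
Definition topp_pure (p : S * N) : seq (S * N) := [:: (- p.1, p.2)].
Definition topp (p : tensor) : tensor := tclass (flatten (map topp_pure (repr p))).

Lemma balanced0l (P : zmodType) (b : S -> N -> P) : balanced f b ->
  forall x, b 0 x = 0.
Proof.
by case=> bDl _ _ x; apply: (@addrI _ (b 0 x)); rewrite -bDl !addr0.
Qed.

Lemma balanced0r (P : zmodType) (b : S -> N -> P) : balanced f b ->
  forall s, b s 0 = 0.
Proof.
by case=> _ bDr _ s; apply: (@addrI _ (b s 0)); rewrite -bDr !addr0.
Qed.

Lemma balanced_opp (P : zmodType) (b : S -> N -> P) : balanced f b ->
  forall s x, b (- s) x = - b s x.
Proof.
move=> bP s x; apply/eqP; rewrite -addr_eq0.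
by case: (bP) => <- _ _; rewrite addNr balanced0l.
Qed.

Lemma tclass_cat u v : tclass (u ++ v) = tadd (tclass u) (tclass v).
Proof.
apply/tclassP => P b bP; rewrite /tsum !big_cat /=.
by congr (_ + _); apply: (tclassP _ _).2 => //; rewrite tclassK.
Qed.

Lemma topp_pureP (P : zmodType) (b : S -> N -> P) : balanced f b ->
  balanced f (fun s x => tsum b (topp_pure (s, x))).
Proof.
move=> bP; have bN := balanced_opp bP; case: bP => bDl bDr bZ.
split=> *; rewrite /tsum !big_seq1 /=.
- by rewrite opprD bDl.
- by rewrite bDr.
- by rewrite -mulNr bZ.
Qed.

Lemma tclass_opp u : tclass (flatten (map topp_pure u)) = topp (tclass u).
Proof. by apply: tclass_flatten; [exact: topp_pureP | rewrite tclassK]. Qed.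

Lemma taddA : associative tadd.
Proof.
move=> p q r; rewrite -[p]tclassK -[q]tclassK -[r]tclassK.
by rewrite -!tclass_cat catA.
Qed.

Lemma taddC : commutative tadd.
Proof.
move=> p q; rewrite -[p]tclassK -[q]tclassK -!tclass_cat.
by apply/tclassP => P b _; rewrite /tsum !big_cat /= addrC.
Qed.

Lemma tadd0 : left_id (tclass [::]) tadd.
Proof. by move=> p; rewrite -[p]tclassK -tclass_cat. Qed.

Lemma taddN : left_inverse (tclass [::]) topp tadd.
Proof.
move=> p; rewrite -[p]tclassK -tclass_opp -tclass_cat.
apply/tclassP => P b bP; rewrite /tsum big_cat big_flatten big_map big_nil /=.
rewrite -big_split big1 //= => -[s x] _.
by rewrite big_seq1 /= balanced_opp // addNr.
Qed.

HB.instance Definition _ := GRing.isZmodule.Build tensor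
  taddA taddC tadd0 taddN.

Definition tpure (s : S) (x : N) : tensor := tclass [:: (s, x)].

Lemma tclassE u : tclass u = \sum_(p <- u) tpure p.1 p.2.
Proof.
elim: u => [|[s x] u IHu]; first by rewrite big_nil.
by rewrite big_cons -cat1s tclass_cat IHu.
Qed.

Lemma tpure_balanced : balanced f tpure.
Proof.
have E u v : tclass u + tclass v = tclass (u ++ v) by rewrite tclass_cat.
split=> *; rewrite /tpure ?E; apply/tclassP => P b [bDl bDr bZ];
  by rewrite /tsum !big_cons big_nil !addr0 /=.
Qed.

Lemma tensor_universal (P : zmodType) (b : S -> N -> P) : balanced f b ->
  exists g : {additive tensor -> P},
    (forall s x, g (tpure s x) = b s x) /\
    (forall g' : {additive tensor -> P},
       (forall s x, g' (tpure s x) = b s x) -> g' =1 g).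
Proof.
move=> bP; pose g (p : tensor) := tsum b (repr p).
have gE u : g (tclass u) = tsum b u.
  by apply: (tclassP _ _).2 => //; rewrite tclassK.
have gB : zmod_morphism g.
  move=> p q; rewrite -[p]tclassK -[q]tclassK.
  have -> : tclass (repr p) - tclass (repr q) =
            tclass (repr p ++ flatten (map topp_pure (repr q))).
    by rewrite tclass_cat tclass_opp.
  rewrite !gE /tsum big_cat big_flatten big_map /= -sumrN; congr (_ + _).
  by apply: eq_bigr => -[s x] _; rewrite big_seq1 balanced_opp.
pose ga := GRing.isZmodMorphism.Build tensor P g gB.
pose gp : {additive tensor -> P} := HB.pack g ga.
exists gp; split=> [s x|g' g'P p]; first by rewrite /= gE /tsum big_seq1.
rewrite -[p]tclassK /= gE tclassE raddf_sum.
by apply: eq_bigr => -[s x] _ /=.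
Qed.

End Tensor.

(* S ⊗_R M as a module over M_n(S), identified with S ⊗_R M_n(R): a matrix A
   over S corresponds to the sum of the A_ij ⊗ e_ij. See also
   [base_change_scale_pure]. *)
Definition base_change (R S : comPzRingType) (f : {rmorphism R -> S}) (n : nat)
  (M : lmodType 'M[R]_n) : Type := tensor f (scalar_restr M).

Section BaseChange.
Variables (R S : comPzRingType) (f : {rmorphism R -> S}) (n : nat).
Variable M : lmodType 'M[R]_n.
Local Notation N := (scalar_restr M).
Local Notation T := (base_change f M).

HB.instance Definition _ := GRing.Zmodule.on T.

Definition base_change_pure (A : 'M[S]_n) (p : S * N) : seq (S * N) :=
  [seq (A ij.1 ij.2 * p.1, (delta_mx ij.1 ij.2 : 'M[R]_n) *: (p.2 : M))
     | ij : 'I_n * 'I_n].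

Definition base_change_scale (A : 'M[S]_n) (t : T) : T :=
  tclass f (flatten (map (base_change_pure A) (repr (t : tensor f N)))).

Lemma tsum_base_change_pure (P : zmodType) (b : S -> N -> P) A s x :
  tsum b (base_change_pure A (s, x)) =
  \sum_i \sum_j b (A i j * s) ((delta_mx i j : 'M[R]_n) *: (x : M)).
Proof.
rewrite /tsum /base_change_pure big_map big_enum /= pair_bigA /=.
by apply: eq_bigr.
Qed.

Lemma base_change_pureP A (P : zmodType) (b : S -> N -> P) : balanced f b ->
  balanced f (fun s x => tsum b (base_change_pure A (s, x))).
Proof.
case=> bDl bDr bZ; split=> *; rewrite !tsum_base_change_pure.
- rewrite -big_split; apply: eq_bigr => i _; rewrite -big_split.
  by apply: eq_bigr => j _; rewrite mulrDr bDl.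
- rewrite -big_split; apply: eq_bigr => i _; rewrite -big_split.
  by apply: eq_bigr => j _; rewrite /= (@scalerDr _ M) bDr.
- apply: eq_bigr => i _; apply: eq_bigr => j _; rewrite mulrA bZ.
  by rewrite scalar_restr_scaleC.
Qed.

Lemma tclass_scale A u :
  tclass f (flatten (map (base_change_pure A) u)) =
  base_change_scale A (tclass f u).
Proof. by apply: tclass_flatten; [exact: base_change_pureP|rewrite tclassK]. Qed.

Lemma tsum_flatten (P : zmodType) (b : S -> N -> P) A u :
  tsum b (flatten (map (base_change_pure A) u)) =
  tsum (fun s x => tsum b (base_change_pure A (s, x))) u.
Proof.
by rewrite /tsum big_flatten big_map; apply: eq_bigr => -[s x] _.
Qed.

Lemma balanced_sum (P : zmodType) (b : S -> N -> P) : balanced f b ->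
  forall x I (r : seq I) (F : I -> S),
    b (\sum_(i <- r) F i) x = \sum_(i <- r) b (F i) x.
Proof.
move=> bP x I r F; apply: (big_morph (b^~ x)); last exact: (balanced0l bP).
by move=> s t; case: bP.
Qed.

Lemma balanced_sumr (P : zmodType) (b : S -> N -> P) : balanced f b ->
  forall s I (r : seq I) (F : I -> N),
    b s (\sum_(i <- r) F i) = \sum_(i <- r) b s (F i).
Proof.
move=> bP s I r F; apply: (big_morph (b s)); last exact: (balanced0r bP).
by move=> x y; case: bP.
Qed.

Lemma base_change_scaleA A B t :
  base_change_scale A (base_change_scale B t) = base_change_scale (A * B) t.
Proof.
rewrite -[t]tclassK; move: (repr t) => u.
rewrite -(tclass_scale B) -!tclass_scale; apply/tclassP => P b bP.
rewrite !tsum_flatten; apply: eq_tsum => s x /=.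
rewrite !tsum_base_change_pure.
transitivity (\sum_k \sum_l \sum_i
    b (A i k * (B k l * s)) ((delta_mx i l : 'M[R]_n) *: (x : M))).
  apply: eq_bigr => k _; apply: eq_bigr => l _.
  rewrite tsum_base_change_pure; apply: eq_bigr => i _.
  rewrite (bigD1 k) //= big1 ?addr0 => [|j jk].
    by rewrite scalerA [delta_mx i k * _](mul_delta_mx k i l).
  rewrite scalerA [delta_mx i j * _]mul_delta_mx_0 ?scale0r //.
  exact: (balanced0r bP).
under eq_bigr do rewrite exchange_big /=.
rewrite exchange_big /=; apply: eq_bigr => i _.
rewrite exchange_big /=; apply: eq_bigr => l _.
rewrite mxE mulr_suml balanced_sum //.
by apply: eq_bigr => k _; rewrite mulrA.
Qed.

Lemma base_change_scale_pure (a : S) (A : 'M[R]_n) (s : S) (x : N) :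
  base_change_scale (a *: map_mx f A) (tpure f s x) =
  tpure f (a * s) (A *: (x : M) : N).
Proof.
rewrite -tclass_scale; apply/tclassP => P b bP.
rewrite tsum_flatten /tsum !big_seq1 /= -[LHS]/(tsum _ _) tsum_base_change_pure.
have -> : A *: (x : M) = \sum_i \sum_j A i j *: (delta_mx i j *: (x : M) : N).
  rewrite {1}[A]matrix_sum_delta scaler_suml; apply: eq_bigr => i _.
  rewrite scaler_suml; apply: eq_bigr => j _.
  rewrite -[RHS]/((A i j)%:M *: (delta_mx i j *: x)) scalerA.
  by rewrite -[_%:M * _]/(_ *m _) mul_scalar_mx.
rewrite balanced_sumr //; apply: eq_bigr => i _.
rewrite balanced_sumr //; apply: eq_bigr => j _.
by rewrite !mxE mulrAC; case: bP => _ _ ->.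
Qed.

Lemma base_change_scale1 : left_id 1 base_change_scale.
Proof.
move=> t; rewrite -[t]tclassK; move: (repr t) => u; rewrite -tclass_scale; apply/tclassP => P b bP.
rewrite tsum_flatten -[RHS]/(tsum (fun s x => b s x) _); apply: eq_tsum => s x.
have := base_change_scale_pure 1 1 s x.
rewrite scale1r rmorph1 mul1r scale1r -tclass_scale => /tclassP /(_ P b bP).
by rewrite tsum_flatten /tsum !big_seq1.
Qed.

Lemma base_change_scaleDr : right_distributive base_change_scale +%R.
Proof.
move=> A t u; rewrite -[t]tclassK -[u]tclassK.
change (base_change_scale A (tadd (tclass f (repr t)) (tclass f (repr u))) =
  tadd (base_change_scale A (tclass f (repr t)))
       (base_change_scale A (tclass f (repr u)))).
by rewrite -tclass_cat -!tclass_scale -tclass_cat map_cat flatten_cat.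
Qed.

Lemma base_change_scaleDl t : {morph base_change_scale^~ t : A B / A + B}.
Proof.
move=> A B /=; rewrite -[t]tclassK; move: (repr t) => u; rewrite -!tclass_scale.
rewrite -[RHS]/(tadd _ _) -tclass_cat; apply/tclassP => P b bP.
rewrite [RHS]/tsum big_cat -![in RHS]/(tsum _ _) /= !tsum_flatten -big_split.
apply: eq_bigr => -[s x] _ /=; rewrite !tsum_base_change_pure -big_split.
apply: eq_bigr => i _; rewrite -big_split; apply: eq_bigr => j _ /=.
by rewrite mxE mulrDl; case: bP => ->.
Qed.

HB.instance Definition _ := GRing.Zmodule_isLmodule.Build 'M[S]_n T
  base_change_scaleA base_change_scale1 base_change_scaleDr base_change_scaleDl.

End BaseChange.

(* Main.v *)
Require Import Defs.
From HB Require Import structures.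
From mathcomp Require Import all_boot all_order all_algebra.
From mathcomp Require Import perm boolp classical_sets.

Set Implicit Arguments.
Unset Strict Implicit.
Unset Printing Implicit Defensive.

Import GRing.Theory.
Local Open Scope classical_set_scope.
Local Open Scope ring_scope.

(* The corner e_ii M is an exact functor of M, isomorphic to e_11 M through
   multiplication by e_1i; it turns a presentation of M by a matrix over
   Lambda into a presentation over R by the same matrix with its entries
   regarded as blocks, and M is the direct sum of its n corners as an R-module.
   So everything reduces to Fitting ideals over R, whose properties all follow
   from one inclusion ([presents_minors_sub]): if h presents N, then the
   maximal minors of any matrix of relations among any finite set of
   generators of N lie in the ideal of minors of h. Right exactness of
   S ⊗ - is read off the universal property, by mapping S ⊗ M to the cokernel
   of the base-changed presentation matrix. *)

(** * Generated ideals and their products *)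

Lemma ideal_gen_ideal (A : pzRingType) (X : set A) : is_ideal (ideal_gen X).
Proof.
split=> [I [[I0 _ _] _] //|x y Ix Iy I IX|a x Ix].
  have [[_ ID _] _] := IX; exact: (ID _ _ (Ix _ IX) (Iy _ IX)).
by split=> I IX; have [[_ _ IM] _] := IX; [exact: (IM _ _ (Ix _ IX)).1
  | exact: (IM _ _ (Ix _ IX)).2].
Qed.

Lemma sub_ideal_gen (A : pzRingType) (X : set A) : X `<=` ideal_gen X.
Proof. exact: sub_gen_smallest. Qed.

Lemma ideal_gen_sub (A : pzRingType) (X I : set A) :
  is_ideal I -> X `<=` I -> ideal_gen X `<=` I.
Proof. exact: smallest_sub. Qed.

Lemma ideal_sum (A : pzRingType) (I : set A) (T : Type) (r : seq T)
    (P : pred T) (F : T -> A) :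
  is_ideal I -> (forall i, P i -> I (F i)) -> I (\sum_(i <- r | P i) F i).
Proof. by case=> I0 ID _ IF; apply: (big_ind I). Qed.

(** For fixed [x], the [y] with [K (x * y)] form an ideal, so [y] may be taken in [Y]; then the same
    argument in [x] reduces to [X]. *)
Lemma ideal_mulP (R : comPzRingType) (X Y K : set R) : is_ideal K ->
  (forall x y, X x -> Y y -> K (x * y)) ->
  ideal_mul (ideal_gen X) (ideal_gen Y) `<=` K.
Proof.
move=> KI XYK; apply: ideal_gen_sub => // _ [x [y [Xx Yy ->]]].
have [K0 KD KM] := KI.
suff: ideal_gen Y `<=` [set y | K (x * y)] by apply.
apply: ideal_gen_sub => [|{Yy} y Yy /=].
  split=> [|u v|a u] /=; rewrite ?mulr0 // ?mulrDr; first exact: KD.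
  by move=> Kxu; rewrite mulrCA [x * (u * a)]mulrA; apply: KM.
suff: ideal_gen X `<=` [set x | K (x * y)] by apply.
apply: ideal_gen_sub => [|{Xx} z Xz /=]; last exact: XYK.
split=> [|u v|a u] /=; rewrite ?mul0r // ?mulrDl; first exact: KD.
by move=> Kuy; rewrite -mulrA [u * a * y]mulrAC; apply: KM.
Qed.

Lemma ideal_mul_in (A : pzRingType) (I J : set A) x y :
  I x -> J y -> ideal_mul I J (x * y).
Proof. by move=> Ix Jy; apply: sub_ideal_gen; exists x, y. Qed.

Lemma ideal_mul_subr (A : pzRingType) (I J : set A) :
  is_ideal J -> ideal_mul I J `<=` J.
Proof.
move=> JI; apply: ideal_gen_sub => // _ [x [y [_ Jy ->]]].
by case: JI => _ _ /(_ x y Jy) [].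
Qed.

(** * Determinants and ideals of minors *)

(** By the pigeonhole principle no permutation maps [P] into the smaller set [Q], so every term of
    the Leibniz expansion has a zero factor. *)
Lemma det_block_zero (R : comPzRingType) n (A : 'M[R]_n) (P Q : {set 'I_n}) :
  (#|Q| < #|P|)%N -> (forall i j, i \in P -> j \notin Q -> A i j = 0) ->
  \det A = 0.
Proof.
move=> ltQP A0; rewrite /determinant big1 // => s _.
have [/existsP[i /andP[iP siQ]]|/existsPn sPQ] :=
  boolP [exists i, (i \in P) && (s i \notin Q)].
  by rewrite (bigD1 i) //= (A0 _ _ iP siQ) mul0r mulr0.
have /subset_leq_card : s @: P \subset Q.
  apply/fintype.subsetP => _ /imsetP[i iP ->].
  by have := sPQ i; rewrite iP /= negbK.
by rewrite (card_imset _ perm_inj) leqNgt ltQP.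
Qed.

(** The Cauchy-Binet expansion before grouping: each row of [Z *m h] is a combination of rows of
    [h], and the determinant is multilinear in its rows. The choices [g] of rows may repeat or be
    out of order. *)
Lemma det_mulmx_rowsub (R : comPzRingType) a b (Z : 'M[R]_(b, a))
    (h : 'M[R]_(a, b)) :
  \det (Z *m h) =
  \sum_(g : {ffun 'I_b -> 'I_a}) (\prod_i Z i (g i)) * \det (rowsub g h).
Proof.
transitivity (\sum_(s : 'S_b) \sum_(g : {ffun 'I_b -> 'I_a})
   (\prod_i Z i (g i)) * ((-1) ^+ s * \prod_i h (g i) (s i))).
  apply: eq_bigr => s _; under eq_bigr do rewrite mxE.
  rewrite bigA_distr_bigA mulr_sumr; apply: eq_bigr => g _.
  by rewrite big_split mulrCA.
rewrite exchange_big; apply: eq_bigr => g _; rewrite -mulr_sumr.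
congr (_ * _); apply: eq_bigr => s _; congr (_ * _).
by apply: eq_bigr => i _; rewrite mxE.
Qed.

Lemma minors_ideal_ideal (R : comPzRingType) a b (h : 'M[R]_(a, b)) :
  is_ideal (minors_ideal h).
Proof. exact: ideal_gen_ideal. Qed.
#[local] Hint Resolve minors_ideal_ideal : core.

(** A repeated row gives a zero determinant; otherwise sorting the rows changes it only by the
    determinant of a permutation matrix. Monotonicity of a row choice thus never has to be checked
    later. *)
Lemma det_rowsub_minors (R : comPzRingType) a b (h : 'M[R]_(a, b))
    (g : 'I_b -> 'I_a) :
  minors_ideal h (\det (rowsub g h)).
Proof.
have [I0 _ IM] := minors_ideal_ideal h.
have [/injectiveP g_inj|/injectivePn[i [j ij gij]]] := boolP (injectiveb g);
  last first.
  rewrite (determinant_alternate ij) // => k.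
  by rewrite !mxE gij.
pose G := [set g i | i : 'I_b]%SET.
have cG : b = #|G| by rewrite card_imset // card_ord.
have gG i : g i \in G by apply: imset_f.
(* [f] lists the image of [g] in increasing order, and [s0] is the permutation with
   [g = f \o s0]. *)
pose f i : 'I_a := enum_val (cast_ord cG i).
pose s0 i := cast_ord (esym cG) (enum_rank_in (gG i) (g i)).
have fs0 i : f (s0 i) = g i by rewrite /f /s0 cast_ordKV enum_rankK_in.
have s0_inj : injective s0 by move=> i j /(congr1 f); rewrite !fs0; apply: g_inj.
pose s := perm s0_inj.
have -> : rowsub g h = perm_mx s *m rowsub f h.
  by apply/matrixP => i j; rewrite -row_permE !mxE permE fs0.
rewrite det_mulmx; apply: (IM _ _ _).1.
apply: sub_ideal_gen; exists f; split=> // i j ij.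
(* The enumeration of [G] is increasing, being a subsequence of that of ['I_a]. *)
have srt : sorted ltn (map val (enum G)).
  have : subseq (map val (enum G)) (map val (enum 'I_a)).
    by apply: map_subseq; rewrite {1}/enum_mem -enumT filter_subseq.
  move/(subseq_sorted ltn_trans); apply; rewrite val_enum_ord.
  exact: iota_ltn_sorted.
have := sorted_ltn_nth ltn_trans 0%N srt; move/(_ i j).
rewrite !inE size_map -cardE -cG !ltn_ord => /(_ isT isT ij).
rewrite /f !(enum_val_nth (g i)) /=.
by rewrite !(nth_map (g i)) // -cardE -cG.
Qed.

Lemma minors_ideal_mull (R : comPzRingType) a b (Z : 'M[R]_(b, a))
    (h : 'M[R]_(a, b)) :
  minors_ideal h (\det (Z *m h)).
Proof.
have [_ _ IM] := minors_ideal_ideal h.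
rewrite det_mulmx_rowsub; apply: ideal_sum => // g _.
by apply: (IM _ _ _).1; apply: det_rowsub_minors.
Qed.

(** The product of two minors is the determinant of a block triangular matrix, whatever [B] is, and
    this matrix collects the rows of both choices. *)
Lemma minors_block_sub (R : comPzRingType) a1 b1 a3 b3 (h1 : 'M[R]_(a1, b1))
    (B : 'M[R]_(a3, b1)) (h3 : 'M[R]_(a3, b3)) :
  ideal_mul (minors_ideal h1) (minors_ideal h3) `<=`
  minors_ideal (block_mx h1 0 B h3).
Proof.
apply: ideal_mulP => // _ _ [f [_ ->]] [g [_ ->]].
rewrite -(det_lblock _ (rowsub g B)).
pose fg (k : 'I_(b1 + b3)) : 'I_(a1 + a3) :=
  match split k with inl i => lshift a3 (f i) | inr j => rshift a1 (g j) end.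
have fgl i : fg (lshift b3 i) = lshift a3 (f i) by rewrite /fg (unsplitK (inl i)).
have fgr i : fg (rshift b1 i) = rshift a1 (g i) by rewrite /fg (unsplitK (inr i)).
have -> : block_mx (rowsub f h1) 0 (rowsub g B) (rowsub g h3)
    = rowsub fg (block_mx h1 0 B h3).
  apply/matrixP => i j; rewrite [RHS]mxE.
  case: (split_ordP i) => i' ->; rewrite ?fgl ?fgr;
  case: (split_ordP j) => j' ->;
  rewrite ?block_mxEul ?block_mxEur ?block_mxEdl ?block_mxEdr !mxE //.
exact: det_rowsub_minors.
Qed.

(** A minor of the diagonal block matrix vanishes unless exactly [b1] of its rows come from [h1], in
    which case it is a product of two minors. *)
Lemma minors_block_diag (R : comPzRingType) a1 b1 a3 b3 (h1 : 'M[R]_(a1, b1))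
    (h3 : 'M[R]_(a3, b3)) :
  minors_ideal (block_mx h1 0 0 h3) =
  ideal_mul (minors_ideal h1) (minors_ideal h3).
Proof.
apply/seteqP; split; last exact: minors_block_sub.
apply: ideal_gen_sub => [|_ [f [f_mono ->]]]; first exact: ideal_gen_ideal.
have [I0 _ _] := ideal_gen_ideal
  [set z | exists x y, [/\ minors_ideal h1 x, minors_ideal h3 y & z = x * y]].
set H := block_mx h1 0 0 h3.
have f_le (i j : 'I_(b1 + b3)) : (i <= j)%N -> (f i <= f j)%N.
  by rewrite leq_eqVlt => /predU1P[/val_inj -> //|/f_mono/ltnW].
have H0r (k : 'I_(a1 + a3)) (j : 'I_b1) : (a1 <= k)%N -> H k (lshift b3 j) = 0.
  rewrite leqNgt; case: (split_ordP k) => k' -> // _.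
  by rewrite /H block_mxEdl mxE.
have H0l (k : 'I_(a1 + a3)) (j : 'I_b3) : (k < a1)%N -> H k (rshift b1 j) = 0.
  case: (split_ordP k) => k' -> // _.
  by rewrite /H block_mxEur mxE.
(* If one of the first [b1] chosen rows lies in the lower block, so do all the last [b3] by
   monotonicity: [b3 + 1] rows supported on [b3] columns. *)
have [/existsP[i fi]|/existsPn fl] :=
  boolP [exists i : 'I_b1, a1 <= f (lshift b3 i)]%N.
  rewrite (@det_block_zero _ _ _
    (lshift b3 i |: [set rshift b1 j | j : 'I_b3]) [set rshift b1 j | j : 'I_b3]) //.
    rewrite cardsU1; case: imsetP => [[j _ /eqP]|_] //.
    by rewrite eq_lrshift.
  move=> k l; rewrite mxE => kP.
  case: (split_ordP l) => l' ->; last by rewrite imset_f.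
  move=> _; apply: H0r; apply: leq_trans fi (f_le _ _ _).
  move: kP; rewrite !inE => /orP[/eqP -> //|/imsetP[j _ ->]] /=.
  exact/ltnW/ltn_addr.
(* Symmetrically, this would give [b1 + 1] rows supported on [b1] columns. *)
have [/existsP[i fi]|/existsPn fr] :=
  boolP [exists i : 'I_b3, f (rshift b1 i) < a1]%N.
  rewrite (@det_block_zero _ _ _
    (rshift b1 i |: [set lshift b3 j | j : 'I_b1]) [set lshift b3 j | j : 'I_b1]) //.
    rewrite cardsU1; case: imsetP => [[j _ /eqP]|_] //.
    by rewrite eq_sym eq_lrshift.
  move=> k l; rewrite mxE => kP.
  case: (split_ordP l) => l' ->; first by rewrite imset_f.
  move=> _; apply: H0l; apply: leq_ltn_trans (f_le _ _ _) fi.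
  move: kP; rewrite !inE => /orP[/eqP -> //|/imsetP[j _ ->]] /=.
  exact/ltnW/ltn_addr.
have {}fl i : (f (lshift b3 i) < a1)%N by rewrite ltnNge fl.
have {}fr i : (a1 <= f (rshift b1 i))%N by rewrite leqNgt fr.
pose f1 i := Ordinal (fl i).
have fr' i : (f (rshift b1 i) - a1 < a3)%N by rewrite ltn_subLR.
pose f3 i := Ordinal (fr' i).
have f1E i : f (lshift b3 i) = lshift a3 (f1 i) by apply: val_inj.
have f3E i : f (rshift b1 i) = rshift a1 (f3 i).
  by apply: val_inj; rewrite /= subnKC.
have -> : rowsub f H = block_mx (rowsub f1 h1) 0 0 (rowsub f3 h3).
  apply/matrixP => i j; rewrite mxE.
  case: (split_ordP i) => i' ->; rewrite ?f1E ?f3E;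
  case: (split_ordP j) => j' ->;
  rewrite /H ?block_mxEul ?block_mxEur ?block_mxEdl ?block_mxEdr !mxE //.
by rewrite det_lblock; apply: ideal_mul_in; apply: det_rowsub_minors.
Qed.

Lemma minors_ideal_map (R S : comPzRingType) (f : {rmorphism R -> S}) a b
    (h : 'M[R]_(a, b)) :
  minors_ideal (map_mx f h) = ideal_gen (f @` minors_ideal h).
Proof.
apply/seteqP; split; apply: ideal_gen_sub; try exact: ideal_gen_ideal.
  move=> _ [g [g_mono ->]]; apply: sub_ideal_gen; exists (\det (rowsub g h)).
    by apply: sub_ideal_gen; exists g.
  by rewrite -det_map_mx map_mxsub.
move=> _ [x + <-]; set I := minors_ideal _ in x *.
have [I0 ID IM] := minors_ideal_ideal (map_mx f h).
(* The preimage of an ideal under [f] is an ideal, so generators suffice. *)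
suff : I `<=` [set x | minors_ideal (map_mx f h) (f x)] by apply.
apply: ideal_gen_sub => [|_ [g [g_mono ->]] /=].
  split=> /= [|y z|c y]; rewrite ?rmorph0 ?rmorphD ?rmorphM //.
    exact: ID.
  by move=> fy; split; [apply: (IM _ _ _).1 | apply: (IM _ _ _).2].
by rewrite -det_map_mx map_mxsub; apply: det_rowsub_minors.
Qed.

(** * Linear maps from free modules and change of generators *)

Definition mk_linear (A : pzRingType) (U V : lmodType A) (f : U -> V)
    (f_lin : linear f) : {linear U -> V} :=
  HB.pack f (GRing.isLinear.Build A U V *:%R f f_lin).

Section Combinations.
Variables (A : pzRingType) (N : lmodType A) (b : nat) (m : 'I_b -> N).

Definition comb (x : 'rV[A]_b) : N := \sum_j x 0 j *: m j.

Lemma comb_is_linear : linear comb.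
Proof.
move=> r x y; rewrite /comb scaler_sumr -big_split; apply: eq_bigr => j _ /=.
by rewrite !mxE scalerDl scalerA.
Qed.

HB.instance Definition _ :=
  GRing.isLinear.Build A 'rV[A]_b N *:%R comb comb_is_linear.

Lemma linear_rV_comb (p : {linear 'rV[A]_b -> N}) :
  (forall j, p (delta_mx 0 j) = m j) -> p =1 comb.
Proof.
move=> pm x; rewrite {1}[x]row_sum_delta raddf_sum; apply: eq_bigr => j _ /=.
by rewrite linearZ /= pm.
Qed.

End Combinations.

(** Free modules are projective: choose preimages of the basis vectors. Asking only that the image
    of [q] lie in that of [p] allows lifting through the kernel of a surjection in
    [extension_presentation]. *)
Lemma linear_rV_lift (A : pzRingType) (V N : lmodType A) b
    (p : {linear V -> N}) (q : {linear 'rV[A]_b -> N}) :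
  (forall x, exists v, p v = q x) ->
  exists t : {linear 'rV[A]_b -> V}, forall x, p (t x) = q x.
Proof.
move=> pq; have [m mP] := choice (fun j => pq (delta_mx 0 j)).
exists (comb m) => x.
rewrite (@linear_rV_comb _ _ _ (fun j => q (delta_mx 0 j)) q) //.
by rewrite raddf_sum; apply: eq_bigr => j _ /=; rewrite linearZ /= mP.
Qed.

Lemma presents_factor (A : pzRingType) (N : lmodType A) a b (h : 'M[A]_(a, b))
    (p : {linear 'rV[A]_b -> N}) c (W : 'M[A]_(c, b)) :
  (forall x, p x = 0 <-> exists z : 'rV[A]_a, x = z *m h) ->
  (forall i, p (row i W) = 0) -> exists Z, W = Z *m h.
Proof.
move=> pker pW.
have [Z ZP] := choice (fun i => (pker _).1 (pW i)).
exists (\matrix_i Z i); apply/row_matrixP => i.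
by rewrite row_mul rowK.
Qed.

(* Expanding [\det X = \det (block_mx X 0 (- V) 1%:M)] after a change of
   generators which makes the last [b] columns relations among the generators
   presented by [h]. *)
Lemma presents_minors_sub (R : comPzRingType) (N : lmodType R) a b
    (h : 'M[R]_(a, b)) a' b' (h' : 'M[R]_(a', b')) (q : {linear 'rV[R]_b' -> N}) :
  presents N h -> (forall y, exists x, q x = y) -> (forall z, q (z *m h') = 0) ->
  minors_ideal h' `<=` minors_ideal h.
Proof.
move=> [p [p_surj pker]] q_surj qh'.
apply: ideal_gen_sub => // _ [f [_ ->]]; set X := rowsub f h'.
have [t tP] := linear_rV_lift (fun x => p_surj (q x)).
have [v vP] := linear_rV_lift (fun x => q_surj (p x)).
pose U := lin1_mx t; pose V := lin1_mx v.
have qX z : q (z *m X) = 0 by rewrite /X rowsubE mulmxA qh'.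
(* Since [p \o t = q] and [q \o v = p], the map [p] sends the rows of [X *m U] to the images under
   [q] of the rows of [X], which are zero, and it kills the rows of [1%:M - V *m U] because
   [p \o t \o v = p]. *)
have [Z ZP] : exists Z, col_mx (X *m U) (1%:M - V *m U) = Z *m h.
  apply: presents_factor pker _ => i; case: (split_ordP i) => j ->.
    by rewrite rowKu row_mul mul_rV_lin1 tP rowE qX.
  rewrite rowKd linearB /= row_mul row1 linearB /=.
  by rewrite mul_rV_lin1 tP rowE mul_rV_lin1 vP subrr.
have -> : \det X = \det (row_mx (col_mx X (- V)) Z *m block_mx 1%:M 0 0 h).
  rewrite mul_row_block !mulmx0 addr0 add0r mulmx1 -ZP -block_mxEh.
  transitivity (\det (block_mx X 0 (- V) 1%:M *m block_mx 1%:M U 0 1%:M)).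
    by rewrite det_mulmx det_lblock det_ublock !det1 !mulr1.
  congr (\det _); rewrite mulmx_block !mulmx0 !mulmx1 !addr0.
  by rewrite mulNmx addrC.
have := @minors_ideal_mull _ _ _ (row_mx (col_mx X (- V)) Z)
  (block_mx (1%:M : 'M_b') 0 0 h).
by rewrite minors_block_diag; apply: ideal_mul_subr.
Qed.

(** * Fitting ideals over a commutative ring *)

(** Independence of the presentation: [get] returns the ideal of some [h'] presenting the same
    module, and [presents_minors_sub] applies in both directions. *)
Lemma Fit_presents (R : comPzRingType) (N : lmodType R) a b (h : 'M[R]_(a, b)) :
  presents N h -> Fit N = minors_ideal h.
Proof.
move=> Nh; have [a' [b' [h' [Nh' ->]]]] : [set I | exists a b (h : 'M[R]_(a, b)),
    presents N h /\ I = minors_ideal h] (Fit N).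
  by apply: getPex; exists (minors_ideal h); exists a, b, h.
have [q [q_surj qker]] := Nh; have [q' [q'_surj q'ker]] := Nh'.
apply/seteqP; split.
  by apply: (presents_minors_sub Nh q'_surj) => z; apply/q'ker; exists z.
by apply: (presents_minors_sub Nh' q_surj) => z; apply/qker; exists z.
Qed.

(** The images under [g] of the generators of [N1] generate [N2], and the relations [h1] still hold
    among them. *)
Lemma Fit_epi (R : comPzRingType) (N1 N2 : lmodType R) (g : {linear N1 -> N2}) :
  finitely_presented N1 -> finitely_presented N2 ->
  (forall y, exists x, g x = y) -> Fit N1 `<=` Fit N2.
Proof.
move=> [a1 [b1 [h1 Nh1]]] [a2 [b2 [h2 Nh2]]] g_surj.
rewrite (Fit_presents Nh1) (Fit_presents Nh2).
have [p [p_surj pker]] := Nh1.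
apply: (@presents_minors_sub _ _ _ _ _ _ _ _ (g \o p) Nh2) => [y|z] /=.
  by have [x <-] := g_surj y; have [w <-] := p_surj x; exists w.
by rewrite (pker _).2 ?raddf0 //; exists z.
Qed.

(** Cramer's rule: for a choice [X] of rows of [h], the vector [\det X *: y = y *m \adj X *m X] is a
    combination of rows of [h], hence a relation. *)
Lemma Fit_annihilator (R : comPzRingType) (N : lmodType R) :
  finitely_presented N -> Fit N `<=` annihilator N.
Proof.
move=> [a [b [h Nh]]]; rewrite (Fit_presents Nh).
have [p [p_surj pker]] := Nh.
apply: ideal_gen_sub => [|_ [f [_ ->]] x].
  split=> [x|r s Nr Ns x|c r Nr]; first by rewrite scale0r.
    by rewrite scalerDl Nr Ns addr0.
  by split=> x; rewrite -scalerA Nr // scaler0.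
have [y <-] := p_surj x; rewrite -linearZ /= -mul_mx_scalar -mul_adj_mx mulmxA.
apply/pker; exists (y *m \adj (rowsub f h) *m rowsub f 1%:M).
by rewrite -[in RHS]mulmxA -rowsubE.
Qed.

Lemma presents_iso (A : pzRingType) (N1 N2 : lmodType A) (g : {linear N1 -> N2})
    a b (h : 'M[A]_(a, b)) : bijective g -> presents N1 h -> presents N2 h.
Proof.
move=> [g' gK g'K] [p [p_surj pker]]; exists (g \o p); split=> [y|x] /=.
  by have [x px] := p_surj (g' y); exists x; rewrite px g'K.
rewrite -pker; split=> [gp0|->]; last by rewrite raddf0.
by rewrite -[p x]gK gp0 -(raddf0 g) gK.
Qed.

Lemma Fit_iso (R : comPzRingType) (N1 N2 : lmodType R) (g : {linear N1 -> N2}) :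
  finitely_presented N1 -> bijective g -> Fit N1 = Fit N2.
Proof.
move=> [a [b [h Nh]]] /presents_iso /(_ Nh) Nh2.
by rewrite (Fit_presents Nh) (Fit_presents Nh2).
Qed.

Lemma presents_prod (A : pzRingType) (N1 N3 : lmodType A) a1 b1 a3 b3
    (h1 : 'M[A]_(a1, b1)) (h3 : 'M[A]_(a3, b3)) :
  presents N1 h1 -> presents N3 h3 ->
  presents (N1 * N3)%type (block_mx h1 0 0 h3).
Proof.
move=> [p1 [p1_surj p1ker]] [p3 [p3_surj p3ker]].
have p_lin : linear (fun x : 'rV_(b1 + b3) =>
    (p1 (lsubmx x), p3 (rsubmx x)) : (N1 * N3)%type).
  by move=> r x y; rewrite !linearP.
exists (mk_linear p_lin); split=> [[y1 y3]|x] /=.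
  have [x1 <-] := p1_surj y1; have [x3 <-] := p3_surj y3.
  by exists (row_mx x1 x3); rewrite row_mxKl row_mxKr.
split=> [[/p1ker[z1 x1] /p3ker[z3 x3]]|[z ->]].
  exists (row_mx z1 z3); rewrite mul_row_block !mulmx0 addr0 add0r -x1 -x3.
  by rewrite hsubmxK.
rewrite -[z]hsubmxK mul_row_block !mulmx0 addr0 add0r row_mxKl row_mxKr.
by congr (_, _); [apply/p1ker | apply/p3ker]; eexists.
Qed.

Lemma Fit_prod (R : comPzRingType) (N1 N3 : lmodType R) :
  finitely_presented N1 -> finitely_presented N3 ->
  Fit (N1 * N3)%type = ideal_mul (Fit N1) (Fit N3).
Proof.
move=> [a1 [b1 [h1 Nh1]]] [a3 [b3 [h3 Nh3]]].
rewrite (Fit_presents Nh1) (Fit_presents Nh3) (Fit_presents (presents_prod Nh1 Nh3)).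
exact: minors_block_diag.
Qed.

(** * Exact sequences *)

Section Extension.
Variables (R : comPzRingType) (N1 N2 N3 : lmodType R).
Variables (iota : {linear N1 -> N2}) (pi : {linear N2 -> N3}).
Hypothesis exact2 : forall y, pi y = 0 <-> exists x, iota x = y.
Hypothesis pi_surj : forall z, exists y, pi y = z.

(** The horseshoe construction: generators of [N1] together with lifts of generators of [N3]
    generate [N2]. The block rows are always relations, and they are all of them when [iota] is
    injective. *)
Lemma extension_presentation a1 b1 (h1 : 'M[R]_(a1, b1)) a3 b3
    (h3 : 'M[R]_(a3, b3)) : presents N1 h1 -> presents N3 h3 ->
  exists (q : {linear 'rV[R]_(b1 + b3) -> N2}) (B : 'M[R]_(a3, b1)),
  [/\ forall y, exists x, q x = y,
      forall z, q (z *m block_mx h1 0 B h3) = 0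
    & injective iota ->
      forall x, q x = 0 -> exists z, x = z *m block_mx h1 0 B h3].
Proof.
move=> [p1 [p1_surj p1ker]] [p3 [p3_surj p3ker]].
have [t tP] := linear_rV_lift (fun x => pi_surj (p3 x)).
have q_lin : linear (fun x : 'rV_(b1 + b3) => iota (p1 (lsubmx x)) + t (rsubmx x)).
  by move=> r x y; rewrite !linearP scalerDr addrACA.
pose th := t \o mulmxr h3.
(* A relation of [N3], lifted by [t], is killed by [pi]; so its opposite comes from [N1], and [B']
   records it in the generators of [N1]. *)
have [|B' B'P] := @linear_rV_lift _ _ _ _ (iota \o p1) (- 1 \*: th).
  move=> z /=; have [|x xz] := (exact2 (- (t (z *m h3)))).1.
    by rewrite raddfN /= tP (p3ker _).2 ?oppr0 //; exists z.
  by have [w wx] := p1_surj x; exists w; rewrite wx xz scaleN1r.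
pose B := lin1_mx B'.
have BP z : iota (p1 (z *m B)) + t (z *m h3) = 0.
  by rewrite mul_rV_lin1 [iota _]B'P /= scaleN1r addNr.
exists (mk_linear q_lin), B; split=> [y|z|iota_inj x] /=.
- have [x3 x3P] := p3_surj (pi y).
  have [|x1 x1P] := (exact2 (y - t x3)).1; first by rewrite raddfB /= tP x3P subrr.
  have [w wx] := p1_surj x1; exists (row_mx w x3).
  by rewrite row_mxKl row_mxKr wx x1P subrK.
- rewrite -[z]hsubmxK mul_row_block mulmx0 add0r row_mxKl row_mxKr.
  by rewrite raddfD /= (p1ker _).2 ?add0r //; exists (lsubmx z).
- rewrite -[x in X in X -> _]hsubmxK row_mxKl row_mxKr => qx.
  have /p3ker[z3 z3P] : p3 (rsubmx x) = 0.
    have := congr1 pi qx; rewrite raddfD raddf0 /= tP.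
    by rewrite (exact2 _).2 ?add0r //; exists (p1 (lsubmx x)).
  have /p1ker[z1 z1P] : p1 (lsubmx x - z3 *m B) = 0.
    apply: iota_inj; rewrite raddf0 !raddfB /=.
    apply/eqP; rewrite subr_eq0; apply/eqP/(@addIr _ (t (z3 *m h3))).
    by rewrite BP -z3P.
  exists (row_mx z1 z3); rewrite mul_row_block mulmx0 add0r -z1P -z3P subrK.
  by rewrite hsubmxK.
Qed.

(** The block matrix need not present [N2], but its rows are relations among generators of [N2],
    which is all that [presents_minors_sub] requires. *)
Lemma Fit_exact : finitely_presented N1 -> finitely_presented N2 ->
  finitely_presented N3 -> ideal_mul (Fit N1) (Fit N3) `<=` Fit N2.
Proof.
move=> [a1 [b1 [h1 Nh1]]] [a2 [b2 [h2 Nh2]]] [a3 [b3 [h3 Nh3]]].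
rewrite (Fit_presents Nh1) (Fit_presents Nh2) (Fit_presents Nh3).
have [q [B [q_surj qB _]]] := extension_presentation Nh1 Nh3.
apply: subset_trans (presents_minors_sub Nh2 q_surj qB).
exact: minors_block_sub.
Qed.

(* [h3] being square, it factors out of the whole last block of columns, and
   [block_mx h1 0 B 1%:M] presents [N1] with redundant generators. *)
Lemma Fit_exact_quadratic : injective iota -> finitely_presented N1 ->
  has_quadratic_presentation N3 -> ideal_mul (Fit N1) (Fit N3) = Fit N2.
Proof.
move=> iota_inj [a1 [b1 [h1 Nh1]]] [k [h3 Nh3]].
have [q [B [q_surj qB qker]]] := extension_presentation Nh1 Nh3.
have Nh2 : presents N2 (block_mx h1 0 B h3).
  by exists q; split=> // x; split=> [/(qker iota_inj)|[z ->]].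
rewrite (Fit_presents Nh1) (Fit_presents Nh2) (Fit_presents Nh3).
apply/seteqP; split; first exact: minors_block_sub.
apply: ideal_gen_sub => [|_ [g [_ ->]]]; first exact: ideal_gen_ideal.
have -> : block_mx h1 0 B h3 = block_mx h1 0 B 1%:M *m block_mx 1%:M 0 0 h3.
  by rewrite mulmx_block !mulmx0 !mulmx1 !mul0mx mul1mx !addr0 !add0r.
rewrite -mul_rowsub_mx det_mulmx det_lblock det1 mul1r.
apply: ideal_mul_in; last first.
  by rewrite -[h3 in \det h3]mul1mx; apply: minors_ideal_mull.
suff sub : minors_ideal (block_mx h1 0 B 1%:M) `<=` minors_ideal h1.
  by apply: sub; apply: det_rowsub_minors.
have [p1 [p1_surj p1ker]] := Nh1.
(* The [k] redundant generators are the opposites of the images under [p1] of the rows of [B], so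
   that the rows of [row_mx B 1%:M] become relations. *)
have q1_lin : linear (fun x : 'rV_(b1 + k) => p1 (lsubmx x - rsubmx x *m B)).
  move=> r x y; rewrite -linearP; congr (p1 _).
  by rewrite !linearP /= mulmxDl -scalemxAl scalerBr opprD addrACA.
apply: (@presents_minors_sub _ _ _ _ _ _ _ _ (mk_linear q1_lin) Nh1) => [y|z] /=.
  have [x <-] := p1_surj y; exists (row_mx x 0).
  by rewrite row_mxKl row_mxKr mul0mx subr0.
rewrite -[z]hsubmxK mul_row_block mulmx0 add0r mulmx1 row_mxKl row_mxKr addrK.
by apply/p1ker; exists (lsubmx z).
Qed.

End Extension.

(** * Finite powers of a module *)

(** Induction on [k], splitting off the coordinate [ord0]: block diagonal presentations multiply the
    ideals of minors. *)
Lemma presents_ffun (R : comPzRingType) (N : lmodType R) a b (h : 'M[R]_(a, b)) k :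
  presents N h -> exists a' b' (h' : 'M[R]_(a', b')),
    presents {ffun 'I_k -> N} h' /\ minors_ideal h' = ideal_exp (minors_ideal h) k.
Proof.
move=> Nh; elim: k => [|k [a' [b' [h' [Nh' h'E]]]]].
  exists 0%N, 0%N, 0; split.
    exists (comb (fun=> 0)); split=> [y|x].
      by exists 0; apply/ffunP => -[].
    by rewrite (thinmx0 x) raddf0; split=> // _; exists 0; rewrite mul0mx.
  (* The zero module has the empty matrix as presentation; its only minor is 1, so its ideal is the
     whole ring. *)
  apply/seteqP; split=> // r _; rewrite -[r]mulr1 -(det_mx00 (rowsub id 0)).
  have [_ _ IM] := minors_ideal_ideal (0 : 'M[R]_0).
  by apply: (IM _ _ _).1; apply: det_rowsub_minors.
exists (a + a')%N, (b + b')%N, (block_mx h 0 0 h'); split; last first.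
  by rewrite minors_block_diag h'E.
pose g (x : (N * {ffun 'I_k -> N})%type) : {ffun 'I_k.+1 -> N} :=
  [ffun i => oapp x.2 x.1 (unlift ord0 i)].
have g_lin : linear g.
  move=> r x y; apply/ffunP => i; rewrite !ffunE.
  by case: unliftP => [j|] _ //=; rewrite !ffunE.
apply: (@presents_iso _ _ _ (mk_linear g_lin)) (presents_prod Nh Nh').
exists (fun x : {ffun 'I_k.+1 -> N} =>
    (x ord0, [ffun i => x (lift ord0 i)])) => [[x y]|x] /=.
  rewrite ffunE unlift_none /=; congr (_, _).
  by apply/ffunP => i; rewrite !ffunE liftK.
by apply/ffunP => i; rewrite ffunE /=; case: unliftP => [j|] -> //=; rewrite ffunE.
Qed.

Lemma Fit_ffun (R : comPzRingType) (N : lmodType R) k :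
  finitely_presented N -> Fit {ffun 'I_k -> N} = ideal_exp (Fit N) k.
Proof.
move=> [a [b [h Nh]]]; have [a' [b' [h' [Nh' h'E]]]] := presents_ffun k Nh.
by rewrite (Fit_presents Nh) (Fit_presents Nh').
Qed.

(** * Corners of a module over a matrix ring *)

Section Corner.
Variables (R : comPzRingType) (n : nat) (M : lmodType 'M[R]_n) (i : 'I_n).

Lemma mul_delta_mx_scale m (x : M) (j k l : 'I_n) :
  m = k -> (delta_mx j m : 'M[R]_n) *: ((delta_mx k l : 'M[R]_n) *: x) =
  (delta_mx j l : 'M[R]_n) *: x.
Proof. by move=> ->; rewrite scalerA -[_ * _]/(_ *m _) mul_delta_mx. Qed.

Lemma corner_delta (x : corner M i) :
  (delta_mx i i : 'M[R]_n) *: (corner_val x : M) = corner_val x.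
Proof. by have /asboolP[y ->] := corner_valP x; rewrite mul_delta_mx_scale. Qed.

Lemma corner_val_inj (x y : corner M i) :
  (corner_val x : M) = corner_val y -> x = y.
Proof. exact: val_inj. Qed.

Lemma to_cornerP j (x : M) :
  ((delta_mx i j : 'M[R]_n) *: x : scalar_restr M) \in in_corner (M := M) i.
Proof.
by apply/asboolP; exists ((delta_mx i j : 'M[R]_n) *: x); rewrite mul_delta_mx_scale.
Qed.

(** For [j = i] this is the projection onto [e_ii M]; restricted to [e_jj M] it is the isomorphism
    onto [e_ii M], with inverse multiplication by [e_ji]. *)
Definition to_corner j (x : scalar_restr M) : corner M i := Corner (to_cornerP j x).

Lemma to_corner_is_linear j : linear (to_corner j).
Proof.
move=> r x y; apply: val_inj; rewrite linearP /=.
by rewrite (@scalerDr _ M) scalar_restr_scaleC.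
Qed.

HB.instance Definition _ j := GRing.isLinear.Build R (scalar_restr M) (corner M i)
  *:%R (to_corner j) (to_corner_is_linear j).

(** The products [e_ji e_ij = e_jj] sum to the identity matrix. *)
Lemma delta_decomposition (x : M) :
  x = \sum_j (delta_mx j i : 'M[R]_n) *: (corner_val (to_corner j x) : M).
Proof.
under eq_bigr do rewrite mul_delta_mx_scale //.
rewrite -scaler_suml -[LHS]scale1r; congr (_ *: _).
apply/matrixP => k l; rewrite summxE (bigD1 k) //= big1 ?addr0.
  by rewrite !mxE eqxx eq_sym.
by move=> j jk; rewrite mxE eq_sym (negPf jk).
Qed.

(** These coordinates identify [M], over [R], with [n] copies of the single corner [e_ii M]; the
    inverse is given by [delta_decomposition]. *)
Definition corner_tuple (x : scalar_restr M) : {ffun 'I_n -> corner M i} :=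
  [ffun j => to_corner j x].

Lemma corner_tuple_is_linear : linear corner_tuple.
Proof. by move=> r x y; apply/ffunP => j; rewrite !ffunE linearP. Qed.

HB.instance Definition _ := GRing.isLinear.Build R (scalar_restr M)
  {ffun 'I_n -> corner M i} *:%R corner_tuple corner_tuple_is_linear.

Lemma corner_tuple_bij : bijective corner_tuple.
Proof.
exists (fun g : {ffun 'I_n -> corner M i} =>
    \sum_j (delta_mx j i : 'M[R]_n) *: (corner_val (g j) : M)).
  move=> x; rewrite [RHS]delta_decomposition.
  by apply: eq_bigr => j _; rewrite ffunE.
move=> g; apply/ffunP => j; apply: val_inj; rewrite ffunE /=.
rewrite [_ *: _](@scaler_sumr _ M) (bigD1 j) //= big1 ?addr0.
  by rewrite mul_delta_mx_scale // corner_delta.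
move=> k kj; rewrite scalerA [_ * _]mul_delta_mx_0 ?scale0r //.
by rewrite eq_sym.
Qed.

End Corner.

Section CornerMap.
Variables (R : comPzRingType) (n : nat) (M1 M2 : lmodType 'M[R]_n).
Variables (g : {linear M1 -> M2}) (i : 'I_n).

(** The restriction of [g]. Multiplying by [e_ii] again places the value in the corner by
    construction; [corner_mapE] shows that it changes nothing. *)
Definition corner_map (x : corner M1 i) : corner M2 i :=
  to_corner i i (g (corner_val x) : scalar_restr M2).

Lemma corner_mapE x : corner_val (corner_map x) = g (corner_val x) :> M2.
Proof. by rewrite /= -[in RHS]corner_delta linearZ. Qed.

Lemma corner_map_is_linear : linear corner_map.
Proof.
move=> r x y; rewrite -linearP; congr to_corner.
exact: (linearP g (r%:M)).
Qed.

HB.instance Definition _ := GRing.isLinear.Build R (corner M1 i) (corner M2 i)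
  *:%R corner_map corner_map_is_linear.

Lemma corner_map_inj : injective g -> injective corner_map.
Proof.
move=> g_inj x y /(congr1 (fun z => corner_val z : M2)).
by rewrite !corner_mapE => /g_inj/val_inj.
Qed.

(** Multiplying a preimage of [y] by [e_ii] moves it into the corner and keeps its image, as
    [e_ii y = y]. Exactness is preserved for the same reason. *)
Lemma corner_map_surj :
  (forall y, exists x, g x = y) -> forall y, exists x, corner_map x = y.
Proof.
move=> g_surj y; have [x xy] := g_surj (corner_val y).
exists (to_corner i i (x : scalar_restr M1)); apply: corner_val_inj.
by rewrite corner_mapE /= linearZ /= xy corner_delta.
Qed.

End CornerMap.

Lemma corner_map_exact (R : comPzRingType) (n : nat)
    (M1 M2 M3 : lmodType 'M[R]_n) (f : {linear M1 -> M2}) (g : {linear M2 -> M3}) i :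
  (forall y, g y = 0 <-> exists x, f x = y) ->
  forall y : corner M2 i, corner_map g y = 0 <-> exists x, corner_map f x = y.
Proof.
move=> fg y; split=> [/(congr1 (fun z => corner_val z : M3))|[x <-]].
  rewrite corner_mapE => /fg[x xy].
  exists (to_corner i i (x : scalar_restr M1)); apply: corner_val_inj.
  by rewrite corner_mapE /= linearZ /= xy corner_delta.
apply: corner_val_inj; rewrite !corner_mapE.
by apply/fg; eexists.
Qed.

(** * Presenting a corner by the block matrix *)

Section CornerPresentation.
Variables (R : comPzRingType) (n a b : nat) (H : 'M['M[R]_n]_(a, b)).

(** Flattened, [Z] is a row vector of length [a * n], multiplied here by [H] read as a matrix of [n]
    by [n] blocks. *)
Definition corner_rel (Z : 'M[R]_(a, n)) : 'M[R]_(b, n) :=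
  \matrix_(j, l) \sum_k \sum_u Z k u * H k j u l.

Lemma corner_rel_is_linear : linear corner_rel.
Proof.
move=> r Z Z'; apply/matrixP => j l; rewrite !mxE mulr_sumr -big_split.
apply: eq_bigr => k _; rewrite mulr_sumr -big_split; apply: eq_bigr => u _ /=.
by rewrite !mxE mulrDl mulrA.
Qed.

HB.instance Definition _ := GRing.isLinear.Build R 'M[R]_(a, n) 'M[R]_(b, n)
  *:%R corner_rel corner_rel_is_linear.

(* Row [k] of [Z] holds the only nonzero row, of index [i], of the [k]-th entry
   of an element of [e_ii Lambda^c]. *)
Definition corner_row c (i : 'I_n) (Z : 'M[R]_(c, n)) : 'rV['M[R]_n]_c :=
  \row_k \matrix_(u, v) (Z k v *+ (u == i)).

Definition row_corner c (i : 'I_n) (w : 'rV['M[R]_n]_c) : 'M[R]_(c, n) :=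
  \matrix_(k, l) w 0 k i l.

Lemma corner_rowK c i : cancel (@corner_row c i) (row_corner i).
Proof. by move=> Z; apply/matrixP => k l; rewrite !mxE eqxx. Qed.

Lemma row_cornerK c i (w : 'rV['M[R]_n]_c) :
  corner_row i (row_corner i w) = (delta_mx i i : 'M[R]_n) *: w.
Proof.
apply/rowP => k; rewrite !mxE; apply/matrixP => u v; rewrite !mxE.
rewrite (bigD1 i) //= big1 ?addr0 => [|j ji].
  by rewrite !mxE eqxx andbT; case: eqP => _; rewrite ?mul1r ?mul0r.
by rewrite mxE (negPf ji) andbF mul0r.
Qed.

Lemma corner_row_is_linear c i r (Z Z' : 'M[R]_(c, n)) :
  corner_row i (r *: Z + Z') = (r%:M : 'M[R]_n) *: corner_row i Z + corner_row i Z'.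
Proof.
apply/rowP => k; rewrite !mxE -[_ * _]/(_ *m _) mul_scalar_mx.
by apply/matrixP => u v; rewrite !mxE mulrnDl mulrnAr.
Qed.

Lemma row_corner_mul i (w : 'rV['M[R]_n]_a) :
  row_corner i (w *m H) = corner_rel (row_corner i w).
Proof.
apply/matrixP => j l; rewrite !mxE summxE; apply: eq_bigr => k _.
by rewrite mxE; apply: eq_bigr => u _; rewrite mxE.
Qed.

Lemma presents_corner (M : lmodType 'M[R]_n) i :
  presents M H -> presents (corner M i) (lin_mx corner_rel).
Proof.
move=> [p [p_surj pker]].
pose q (y : 'rV[R]_(b * n)) : corner M i :=
  to_corner i i (p (corner_row i (vec_mx y)) : scalar_restr M).
have q_lin : linear q.
  move=> r x y; rewrite /q -linearP; congr to_corner.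
  by rewrite linearP corner_row_is_linear linearP.
have qE y : corner_val (q y) = p (corner_row i (vec_mx y)) :> M.
  by rewrite /= -linearZ -row_cornerK corner_rowK.
exists (mk_linear q_lin); split=> [y|y].
  have [x xy] := p_surj (corner_val y).
  exists (mxvec (row_corner i x)); apply: corner_val_inj.
  by rewrite qE mxvecK row_cornerK linearZ /= xy corner_delta.
split=> [/(congr1 (fun z => corner_val z : M))|[z ->]].
  (* Only row [i] of each entry of the relation [w] contributes, so it can be read off as a vector
     over [R]. *)
  rewrite qE => /pker[w /(congr1 (row_corner i))].
  rewrite corner_rowK row_corner_mul => yE; exists (mxvec (row_corner i w)).
  by rewrite mul_vec_lin /= -yE vec_mxK.
apply: corner_val_inj; rewrite qE; apply/pker.
(* Conversely, the row built from [corner_rel] is [e_ii] times a multiple of [H], and [e_ii] can be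
   absorbed in the coefficients. *)
rewrite -[z]vec_mxK mul_vec_lin mxvecK /= -[X in corner_rel X](corner_rowK i).
rewrite -row_corner_mul row_cornerK scalemxAl.
by eexists.
Qed.

End CornerPresentation.

Lemma corner_fp (R : comPzRingType) n (M : lmodType 'M[R]_n) i :
  finitely_presented M -> finitely_presented (corner M i).
Proof. by move=> [a [b [H /presents_corner MH]]]; do 3!eexists; apply: MH. Qed.

Lemma corner_quadratic (R : comPzRingType) n (M : lmodType 'M[R]_n) i :
  has_quadratic_presentation M -> has_quadratic_presentation (corner M i).
Proof. by move=> [k [H /presents_corner MH]]; do 2!eexists; apply: MH. Qed.

(** * Base change *)

(** The cokernel of the base-changed matrix is needed only as an abelian group, because
    [tensor_universal] produces additive maps. *)
Lemma zmod_quotient (V : zmodType) (G : set V) :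
  G 0 -> (forall x y, G x -> G y -> G (x - y)) ->
  exists (Q : zmodType) (pi : {additive V -> Q}), forall x, pi x = 0 <-> G x.
Proof.
move=> G0 GB; pose P : pred V := fun x => `[< G x >].
have P_closed : zmod_closed P.
  split=> [|x y /asboolP Gx /asboolP Gy]; first exact/asboolP.
  exact/asboolP/GB.
pose PZ : zmodClosed V := HB.pack P (GRing.isZmodClosed.Build V P P_closed).
exists (Quotient.quot PZ : zmodType), (\pi_(Quotient.quot PZ)%qT) => x.
rewrite -(raddf0 (\pi_(Quotient.quot PZ)%qT)); split=> [/eqP|Gx].
  by rewrite -Quotient.idealrBE subr0 => /asboolP.
by apply/eqP; rewrite -Quotient.idealrBE subr0; apply/asboolP.
Qed.

Section BaseChangePresentation.
Variables (R S : comPzRingType) (f : {rmorphism R -> S}) (n : nat).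
Local Notation F := (map_mx f : 'M[R]_n -> 'M[S]_n).

(** Splitting each entry into multiples of matrix units writes any row over ['M[S]_n] as a sum of
    scalars of [S] times rows coming from [R]. *)
Lemma additive_map_rV_eq b (Q : zmodType) (g h : {additive 'rV['M[S]_n]_b -> Q}) :
  (forall s (w : 'rV['M[R]_n]_b),
    g ((s%:M : 'M[S]_n) *: map_mx F w) = h ((s%:M : 'M[S]_n) *: map_mx F w)) ->
  g =1 h.
Proof.
move=> gh y.
have -> : y = \sum_j \sum_k \sum_l ((y 0 j k l)%:M : 'M[S]_n) *:
    map_mx F (\row_i (delta_mx k l *+ (i == j)) : 'rV['M[R]_n]_b).
  apply/rowP => j; rewrite summxE (bigD1 j) //= [X in _ + X]big1 ?addr0 => [|i ij].
    rewrite [y 0 j in LHS]matrix_sum_delta summxE; apply: eq_bigr => k _.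
    rewrite summxE; apply: eq_bigr => l _.
    by rewrite !mxE eqxx -[_ * _]/(_ *m _) mul_scalar_mx map_delta_mx.
  rewrite summxE big1 // => k _; rewrite summxE big1 // => l _.
  by rewrite !mxE eq_sym (negPf ij) mulr0n raddf0 mulr0.
rewrite !raddf_sum; apply: eq_bigr => j _; rewrite !raddf_sum.
by apply: eq_bigr => k _; rewrite !raddf_sum; apply: eq_bigr => l _.
Qed.

Lemma map_corner_rel a b (H : 'M['M[R]_n]_(a, b)) :
  map_mx f (lin_mx (corner_rel H)) = lin_mx (corner_rel (map_mx F H)).
Proof.
apply: map_lin_mx => Z; apply/matrixP => j l; rewrite !mxE rmorph_sum.
apply: eq_bigr => k _; rewrite rmorph_sum; apply: eq_bigr => u _.
by rewrite rmorphM !mxE.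
Qed.

Variables (M : lmodType 'M[R]_n) (a b : nat) (H : 'M['M[R]_n]_(a, b)).

Lemma presents_base_change :
  presents M H -> presents (base_change f M) (map_mx F H).
Proof.
move=> [p [p_surj pker]].
pose T := base_change f M.
have tpb := @tpure_balanced _ _ f (scalar_restr M).
pose pS : {linear 'rV['M[S]_n]_b -> T} :=
  comb (fun j => tpure f 1 (p (delta_mx 0 j) : scalar_restr M) : T).
have pSE s w : pS ((s%:M : 'M[S]_n) *: map_mx F w) =
    tpure f s (p w : scalar_restr M).
  rewrite (@linear_rV_comb _ _ _ (fun j => p (delta_mx 0 j)) p) //.
  rewrite (balanced_sumr tpb); apply: eq_bigr => j _; rewrite !mxE.
  rewrite -[_ * _]/(_ *m _) mul_scalar_mx -[RHS]/(tpure f s _ : T).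
  by rewrite -[in RHS](mulr1 s) -base_change_scale_pure.
have pSE1 w : pS (map_mx F w) = tpure f 1 (p w : scalar_restr M)
    by rewrite -pSE scale1r.
exists pS; split=> [t|y].
  rewrite -[t]tclassK tclassE; elim: (repr _) => [|[s x] u [y yu]].
    by exists 0; rewrite big_nil raddf0.
  have [w <-] := p_surj x; exists ((s%:M : 'M[S]_n) *: map_mx F w + y).
  by rewrite raddfD big_cons /= pSE yu.
split=> [|[z ->]]; last first.
  rewrite mulmx_sum_row raddf_sum big1 //= => k _; rewrite linearZ /= -map_row pSE1.
  rewrite (pker _).2 ?(balanced0r tpb) ?scaler0 //.
  by exists (delta_mx 0 k); rewrite rowE.
(* It remains to see that the kernel of [pS] is no larger than the row span. For this the projection
   [pi] onto the cokernel is shown to factor through [pS]. *)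
have [||Q [pi piP]] :=
    @zmod_quotient _ [set y | exists z : 'rV_a, y = z *m map_mx F H].
- by exists 0; rewrite mul0mx.
- by move=> _ _ [z ->] [z' ->]; exists (z - z'); rewrite mulmxBl.
pose beta s w := pi ((s%:M : 'M[S]_n) *: map_mx F w).
have betaB s w w' : beta s (w - w') = beta s w - beta s w'.
  by rewrite /beta map_mxB scalerBr raddfB.
have beta_eq s w w' : p w = p w' -> beta s w = beta s w'.
  move=> ww'; apply/eqP; rewrite -subr_eq0 -betaB; apply/eqP/piP.
  have /pker[z ->] : p (w - w') = 0 by rewrite raddfB /= ww' subrr.
  by exists ((s%:M : 'M[S]_n) *: map_mx F z); rewrite -scalemxAl map_mxM.
(* [rep] is an arbitrary section of [p]; by [beta_eq] the choice of preimages does not affect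
   [beta], which makes the map balanced. *)
have [rep repP] := choice p_surj.
have bb : balanced f (fun s (x : scalar_restr M) => beta s (rep x)).
  split=> [s t x|s x y'|s r x].
  - by rewrite /beta raddfD scalerDl raddfD.
  - rewrite -raddfD -scalerDr -map_mxD; apply: beta_eq.
    by rewrite raddfD /= !repP.
  - rewrite [RHS](@beta_eq _ _ ((r%:M : 'M[R]_n) *: rep x)); last first.
      by rewrite linearZ /= !repP.
    by rewrite /beta map_mxZ /= map_scalar_mx scalerA scalar_mxM.
have [g [gP _]] := tensor_universal bb.
have gpS w : g (pS w) = pi w.
  have g_pi := @additive_map_rV_eq _ _ (g \o pS) pi.
  rewrite -[LHS]/((g \o pS) w) g_pi // => s w' /=.
  by rewrite pSE gP; apply: beta_eq; rewrite repP.
by move=> py; apply/piP; rewrite -gpS py raddf0.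
Qed.

End BaseChangePresentation.

(** * Two-sided ideals of a matrix ring *)

Lemma mul_delta_mx_delta (R : comPzRingType) m n p q (A : 'M[R]_(n, p))
    (k : 'I_m) i j (l : 'I_q) :
  delta_mx k i *m A *m delta_mx j l = A i j *: delta_mx k l.
Proof.
rewrite -(mul_delta_mx (0 : 'I_1) k i) -(mul_delta_mx (0 : 'I_1) j l) !mulmxA.
rewrite -[delta_mx k 0 *m delta_mx 0 i *m A]mulmxA -rowE.
rewrite -[_ *m row i A *m _]mulmxA -colE [col j _]mx11_scalar !mxE.
by rewrite mul_mx_scalar -scalemxAl mul_delta_mx.
Qed.

Section MatrixIdeal.
Variables (R : comPzRingType) (n : nat) (I : set 'M[R]_n.+1).
Hypothesis I_ideal : is_ideal I.

Definition scalar_ideal : set R := [set r | I r%:M].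

Lemma scalar_ideal_ideal : is_ideal scalar_ideal.
Proof.
have [I0 ID IM] := I_ideal; split=> [|x y Ix Iy|c x Ix]; rewrite /scalar_ideal /=.
- by rewrite raddf0.
- by rewrite raddfD; apply: ID.
- by rewrite !scalar_mxM; apply: IM.
Qed.

(** The scalar matrix of an entry [A i j] is the sum over [k] of [e_ki A e_jk], so it lies in [I];
    conversely [A] is the sum of its entries times matrix units. *)
Lemma matrix_idealE : I = ideal_mx scalar_ideal.
Proof.
have [I0 ID IM] := I_ideal; apply/seteqP; split=> A IA.
  move=> i j; rewrite /scalar_ideal /=.
  have -> : (A i j)%:M = \sum_k delta_mx k i *m A *m delta_mx j k :> 'M_n.+1.
    under eq_bigr do rewrite mul_delta_mx_delta.
    by rewrite -scaler_sumr -mx1_sum_delta scalemx1.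
  apply: ideal_sum => // k _; apply: (IM _ _ _).2; exact: (IM _ _ _).1.
rewrite [A]matrix_sum_delta; apply: ideal_sum => // i _.
apply: ideal_sum => // j _; rewrite -mul_scalar_mx.
by apply: (IM _ _ _).2; apply: IA.
Qed.

End MatrixIdeal.

Lemma ideal_mx_ideal (R : pzRingType) n (J : set R) :
  is_ideal J -> is_ideal (ideal_mx J : set 'M[R]_n).
Proof.
move=> JI; have [J0 JD JM] := JI.
split=> [i j|A B JA JB i j|A B JB]; rewrite ?mxE //; first exact: JD.
split=> i j; rewrite mxE; apply: ideal_sum => // k _.
  by apply: (JM _ _ _).1; apply: JB.
by apply: (JM _ _ _).2; apply: JB.
Qed.

(** Matrices with entries in the ideal on the right form an ideal containing [s], and a scalar
    matrix shows its scalar at position [(0, 0)]; the converse is [matrix_idealE]. *)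
Lemma scalar_ideal_fg (R : comPzRingType) n (s : seq 'M[R]_n.+1) :
  scalar_ideal (ideal_gen [set A | A \in s]) =
  ideal_gen [set r | r \in [seq A ij.1 ij.2 | A : 'M[R]_n.+1 <- s,
                             ij <- enum {: 'I_n.+1 * 'I_n.+1}]].
Proof.
set t := [seq _ | A <- s, ij <- _]; set I := ideal_gen [set A | A \in s].
have II : is_ideal I := ideal_gen_ideal _.
apply/seteqP; split=> [r Ir|].
  have sub : I `<=` ideal_mx (ideal_gen [set r | r \in t]).
    apply: ideal_gen_sub => [|A As i j]; first exact/ideal_mx_ideal/ideal_gen_ideal.
    apply: sub_ideal_gen; apply/allpairsP; exists (A, (i, j)).
    by split=> //=; rewrite mem_enum.
  by have := sub _ Ir 0 0; rewrite mxE eqxx.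
apply: ideal_gen_sub => [|_ /allpairsP[[A [i j]] [As _ ->]]].
  exact: scalar_ideal_ideal.
have : I A by apply: sub_ideal_gen.
by rewrite {1}(matrix_idealE II) => /(_ i j).
Qed.

(** * Quotient rings and their Fitting ideals *)

HB.instance Definition _ (A : pzRingType) (I : ideal A) :=
  GRing.isZmodMorphism.Build A (quot_ring I) (quot_class I)
    (raddfB (\pi_(Quotient.quot (GRing.ZmodClosed.clone A (in_ideal I) _))%qT)).

HB.instance Definition _ (A : pzRingType) (I : ideal A) :=
  GRing.isMonoidMorphism.Build A (quot_ring I) (quot_class I)
    (conj (erefl _) (@quot_classM A I)).

Lemma quot_class0P (A : pzRingType) (I : ideal A) x :
  quot_class I x = 0 <-> (I : set A) x.
Proof. by rewrite -(raddf0 (quot_class I)) quot_class_eq subr0. Qed.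

Section QuotientFitting.
Variables (R : comPzRingType) (J : ideal R) (s : seq R).
Hypothesis Js : (J : set R) = ideal_gen [set r | r \in s].

Lemma ideal_gen_seqP x : ideal_gen [set r | r \in s] x <->
  exists z : 'rV[R]_(size s), x = \sum_i z 0 i * s`_i.
Proof.
have GI := ideal_gen_ideal [set r | r \in s]; split; last first.
  move=> [z ->]; apply: ideal_sum => // i _; have [_ _ GM] := GI.
  by apply: (GM _ _ _).1; apply: sub_ideal_gen; apply: mem_nth.
suff sub : ideal_gen [set r | r \in s] `<=`
  [set x | exists z : 'rV[R]_(size s), x = \sum_i z 0 i * s`_i] by apply: sub.
apply: ideal_gen_sub => [|r rs].
  split=> [|_ _ [z ->] [z' ->]|c _ [z ->]].
  - by exists 0; rewrite big1 // => i _; rewrite mxE mul0r.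
  - exists (z + z'); rewrite -big_split; apply: eq_bigr => i _.
    by rewrite mxE mulrDl.
  - rewrite [_ * c]mulrC; split; exists (c *: z); rewrite mulr_sumr;
    by apply: eq_bigr => i _; rewrite mxE mulrA.
have ri : (index r s < size s)%N by rewrite index_mem.
exists (delta_mx 0 (Ordinal ri)); rewrite (bigD1 (Ordinal ri)) //= big1 ?addr0.
  by rewrite mxE !eqxx mul1r nth_index.
by move=> i ir; rewrite mxE (negPf ir) andbF mul0r.
Qed.

Let h : 'cV[R]_(size s) := \col_i s`_i.

Lemma presents_quot : presents (quot_ring J) h.
Proof.
have q_lin : linear (fun x : 'rV[R]_1 => quot_class J (x 0 0)).
  by move=> r x y; rewrite !mxE quot_classD quot_classM.
exists (mk_linear q_lin); split=> [y|x] /=.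
  by exists (\row_i repr y); rewrite mxE quot_classK.
rewrite quot_class0P Js ideal_gen_seqP; split=> -[z zP]; exists z.
  apply/matrixP => i j; rewrite !ord1 zP mxE.
  by apply: eq_bigr => k _; rewrite !mxE.
by rewrite zP mxE; apply: eq_bigr => k _; rewrite !mxE.
Qed.

(** The quotient is cyclic and presented by a column of generators of [J], whose maximal minors are
    its entries. *)
Lemma Fit_quot : Fit (quot_ring J) = J.
Proof.
rewrite (Fit_presents presents_quot) Js; apply/seteqP.
split; apply: ideal_gen_sub; try exact: ideal_gen_ideal.
  move=> _ [g [_ ->]]; rewrite det_mx11 !mxE.
  by apply: sub_ideal_gen; apply: mem_nth.
move=> r rs; have ri : (index r s < size s)%N by rewrite index_mem.
have := @det_rowsub_minors _ _ _ h (fun=> Ordinal ri).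
by rewrite det_mx11 !mxE /= nth_index.
Qed.

End QuotientFitting.

Section MatrixQuotient.
Variables (R : comPzRingType) (n : nat).
Variables (I : ideal 'M[R]_n.+1) (J : ideal R).
Hypothesis IJ : (I : set 'M[R]_n.+1) = ideal_mx J.

Lemma map_quot_class_eq (A B : 'M[R]_n.+1) :
  map_mx (quot_class J) A = map_mx (quot_class J) B <->
  quot_class I A = quot_class I B.
Proof.
rewrite quot_class_eq IJ; split=> [/matrixP AB i j|AB].
  by have := AB i j; rewrite !mxE => /quot_class_eq.
apply/matrixP => i j; rewrite !mxE; apply/quot_class_eq.
by have := AB i j; rewrite !mxE.
Qed.

Definition quot_mx (q : quot_ring I) : 'M[quot_ring J]_n.+1 :=
  map_mx (quot_class J) (repr q).

Lemma quot_mxE A : quot_mx (quot_class I A) = map_mx (quot_class J) A.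
Proof. by apply/map_quot_class_eq; rewrite quot_classK. Qed.

Lemma quot_mx_is_zmod_morphism : zmod_morphism quot_mx.
Proof.
move=> p q; rewrite -[p]quot_classK -[q]quot_classK -raddfB !quot_mxE.
exact: map_mxB.
Qed.

Lemma quot_mx_is_monoid_morphism : monoid_morphism quot_mx.
Proof.
split=> [|p q]; first by rewrite -(rmorph1 (quot_class I)) quot_mxE map_mx1.
rewrite -[p]quot_classK -[q]quot_classK -rmorphM !quot_mxE.
exact: map_mxM.
Qed.

Definition quot_mx_rmorphism : {rmorphism quot_ring I -> 'M[quot_ring J]_n.+1} :=
  HB.pack quot_mx
    (GRing.isZmodMorphism.Build _ _ quot_mx quot_mx_is_zmod_morphism)
    (GRing.isMonoidMorphism.Build _ _ quot_mx quot_mx_is_monoid_morphism).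

Lemma quot_mx_inv (B : 'M[quot_ring J]_n.+1) :
  quot_mx (quot_class I (\matrix_(i, j) repr (B i j))) = B.
Proof.
by rewrite quot_mxE; apply/matrixP => i j; rewrite !mxE quot_classK.
Qed.

Lemma quot_mx_bij : bijective quot_mx.
Proof.
exists (fun B : 'M_n.+1 => quot_class I (\matrix_(i, j) repr (B i j)));
  last exact: quot_mx_inv.
move=> q; rewrite -[RHS]quot_classK -[q in RHS]quot_classK.
by apply/map_quot_class_eq; rewrite -!quot_mxE quot_mx_inv !quot_classK.
Qed.

Lemma quot_mx_scale (A : 'M[R]_n.+1) q :
  quot_mx (A *: q) = map_mx (quot_class J) A *m quot_mx q.
Proof. by rewrite -quot_mxE; apply: (rmorphM quot_mx_rmorphism). Qed.

(** Elements of this corner are matrices whose only nonzero row is the first, so the corner is a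
    free module of rank [n.+1] over the quotient by [J]. *)
Definition corner_quot (x : corner (quot_ring I) ord0) :
    {ffun 'I_n.+1 -> quot_ring J} :=
  [ffun j => quot_mx (corner_val x) 0 j].

Lemma corner_quot_is_linear : linear corner_quot.
Proof.
move=> r x y; apply/ffunP => j; rewrite !ffunE.
rewrite -[quot_mx (corner_val _)]/(quot_mx ((r%:M : 'M[R]_n.+1) *:
  (corner_val x : quot_ring I) + (corner_val y : quot_ring I))).
rewrite [quot_mx _](raddfD quot_mx_rmorphism) mxE /=.
by rewrite quot_mx_scale map_scalar_mx mul_scalar_mx mxE.
Qed.

Lemma corner_quotE x :
  quot_mx (corner_val x) = \matrix_(i, j) (corner_quot x j *+ (i == 0)).
Proof.
rewrite -corner_delta quot_mx_scale map_delta_mx; apply/matrixP => i j.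
rewrite !mxE ffunE -[in RHS]corner_delta quot_mx_scale map_delta_mx.
rewrite !mxE (bigD1 0) //= big1 ?addr0 => [|k k0]; last first.
  by rewrite mxE (negPf k0) andbF mul0r.
rewrite (bigD1 0) //= big1 ?addr0 => [|k k0]; last first.
  by rewrite mxE (negPf k0) andbF mul0r.
by rewrite !mxE !eqxx andbT mul1r mulr_natl.
Qed.

Lemma corner_quot_bij : bijective corner_quot.
Proof.
have inj : injective corner_quot.
  move=> x y xy; apply: corner_val_inj; apply: (bij_inj quot_mx_bij).
  by rewrite !corner_quotE xy.
pose g' (g : {ffun 'I_n.+1 -> quot_ring J}) : corner (quot_ring I) ord0 :=
  to_corner ord0 ord0 (quot_class I (\matrix_(i, j) repr (g j))
    : scalar_restr (quot_ring I)).
have g'K : cancel g' corner_quot.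
  move=> g; apply/ffunP => j; rewrite ffunE /= quot_mx_scale map_delta_mx.
  rewrite quot_mxE mxE (bigD1 0) //= big1 ?addr0 => [|k k0].
    by rewrite !mxE !eqxx mul1r quot_classK.
  by rewrite mxE (negPf k0) andbF mul0r.
by exists g' => // x; apply: inj; rewrite g'K.
Qed.

Lemma FitMx_quot : fg_ideal J -> FitMx (quot_ring I) = ideal_exp J n.+1.
Proof.
move=> [s Js]; have J_pres := presents_quot Js.
have J_fp : finitely_presented (quot_ring J) by do 3!eexists; apply: J_pres.
rewrite -(Fit_quot Js) -(Fit_ffun n.+1 J_fp).
have [g gK g'K] := corner_quot_bij.
(* The inverse is used because [Fit_iso] needs a finitely presented source, and this is known for
   the power of [quot_ring J]. *)
have g_lin := @can2_linear _ _ _ (mk_linear corner_quot_is_linear) _ gK g'K.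
have [a [b [h [Nh _]]]] := presents_ffun n.+1 J_pres.
symmetry; apply: (Fit_iso (g := mk_linear g_lin)).
  by exists a, b, h.
by exists corner_quot.
Qed.

End MatrixQuotient.

(** * Fitting ideals over the matrix ring *)

Lemma Fit_corner_eq (R : comPzRingType) n (M : lmodType 'M[R]_n) (i j : 'I_n) :
  finitely_presented M -> Fit (corner M i) = Fit (corner M j).
Proof.
move=> fpM; have g_lin : linear (fun x : corner M i => to_corner j i (corner_val x)).
  move=> r x y; exact: (linearP (to_corner j i) r (corner_val x) (corner_val y)).
apply: (Fit_iso (g := mk_linear g_lin)); first exact: corner_fp.
exists (fun x : corner M j => to_corner i j (corner_val x)) => x;
  by apply: corner_val_inj => /=; rewrite mul_delta_mx_scale // corner_delta.
Qed.

(** If [r] kills the first corner, it kills every [e_1j x], and [x] is the sum of the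
    [e_j1 e_1j x]. *)
Lemma FitMx_annihilator (R : comPzRingType) n (M : lmodType 'M[R]_n.+1) :
  finitely_presented M -> FitMx M `<=` annihilator (scalar_restr M).
Proof.
move=> fpM r Fr x; rewrite (delta_decomposition ord0 x) scaler_sumr big1 // => j _.
have r0 := Fit_annihilator (corner_fp ord0 fpM) Fr (to_corner ord0 j x).
rewrite -scalar_restr_scaleC -[r *: _]/(corner_val (r *: to_corner ord0 j x)) r0.
exact: (@scaler0 _ M).
Qed.

Lemma corner_prod (R : comPzRingType) n (M1 M2 M3 : lmodType 'M[R]_n) (i : 'I_n)
    (phi : {linear M2 -> (M1 * M3)%type}) :
  bijective phi ->
  exists g : {linear corner M2 i -> (corner M1 i * corner M3 i)%type}, bijective g.
Proof.
move=> [psi phiK psiK].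
have psi_lin := can2_linear phiK psiK; pose psi' := mk_linear psi_lin.
have fst_lin : linear (fun x => (phi x).1) by move=> r x y; rewrite linearP.
have snd_lin : linear (fun x => (phi x).2) by move=> r x y; rewrite linearP.
have g_lin : linear (fun x : corner M2 i =>
  (corner_map (mk_linear fst_lin) x, corner_map (mk_linear snd_lin) x)).
  by move=> r x y; rewrite !linearP.
exists (mk_linear g_lin).
exists (fun y : (corner M1 i * corner M3 i)%type => to_corner i i
  (psi (corner_val y.1 : M1, corner_val y.2 : M3) : scalar_restr M2)).
  move=> x; apply: corner_val_inj => /=.
  have xE : (delta_mx i i : 'M[R]_n) *: phi (corner_val x) = phi (corner_val x).
    by rewrite -linearZ /= corner_delta.
  by rewrite -[(_, _)]/(_ *: phi (corner_val x)) !xE phiK corner_delta.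
move=> [y1 y3] /=; congr (_, _); apply: corner_val_inj; rewrite corner_mapE /=;
  by rewrite linearZ /= psiK /= corner_delta.
Qed.

Theorem theorem2p4 (R : comPzRingType) (n : nat)
    (M M1 M2 M3 : lmodType 'M[R]_n.+1)
    (fpM : finitely_presented M) (fpM1 : finitely_presented M1)
    (fpM2 : finitely_presented M2) (fpM3 : finitely_presented M3) :
  (* (i) *)
  (forall i : 'I_n.+1, FitMx M = Fit (corner M i)) /\
  (* (ii) *)
  FitMx M `<=` annihilator (scalar_restr M) /\
  (* (iii) *)
  (forall p : {linear M1 -> M2}, (forall y, exists x, p x = y) ->
    FitMx M1 `<=` FitMx M2) /\
  (* (iv) *)
  (forall phi : {linear M2 -> (M1 * M3)%type}, bijective phi ->
    FitMx M2 = ideal_mul (FitMx M1) (FitMx M3)) /\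
  (* (v) *)
  (forall (iota : {linear M1 -> M2}) (p : {linear M2 -> M3}),
    (forall y, p y = 0 <-> exists x, iota x = y) ->
    (forall z, exists y, p y = z) ->
    ideal_mul (FitMx M1) (FitMx M3) `<=` FitMx M2) /\
  (* (vi) *)
  (forall (iota : {linear M1 -> M2}) (p : {linear M2 -> M3}),
    injective iota ->
    (forall y, p y = 0 <-> exists x, iota x = y) ->
    (forall z, exists y, p y = z) ->
    has_quadratic_presentation M3 ->
    ideal_mul (FitMx M1) (FitMx M3) = FitMx M2) /\
  (* (vii) *)
  (forall (S : comPzRingType) (f : {rmorphism R -> S}),
    FitMx (base_change f M) = ideal_gen (f @` FitMx M)) /\
  (* (viii) *)
  Fit (scalar_restr M) = ideal_exp (FitMx M) n.+1 /\
  (* (ix) *)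
  (forall I : ideal 'M[R]_n.+1, fg_ideal I ->
    exists J : ideal R,
      [/\ (I : set 'M[R]_n.+1) = ideal_mx J,
          exists phi : {rmorphism quot_ring I -> 'M[quot_ring J]_n.+1},
            bijective phi /\
            forall A, phi (quot_class I A) = map_mx (quot_class J) A
        & FitMx (quot_ring I) = ideal_exp J n.+1]).
Proof.
have fp (N : lmodType 'M[R]_n.+1) :
  finitely_presented N -> finitely_presented (corner N ord0) by exact: corner_fp.
split; first by move=> i; apply: Fit_corner_eq.
split; first exact: FitMx_annihilator.
split.
  move=> p p_surj; rewrite /FitMx.
  exact: (Fit_epi (fp _ fpM1) (fp _ fpM2) (corner_map_surj p_surj)).
split.
  move=> phi /(corner_prod ord0)[g g_bij].
  rewrite /FitMx (Fit_iso (fp _ fpM2) g_bij).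
  exact: (Fit_prod (fp _ fpM1) (fp _ fpM3)).
split.
  move=> iota p ip p_surj; rewrite /FitMx.
  apply: (Fit_exact (corner_map_exact ip) (corner_map_surj p_surj)); exact: fp.
split.
  move=> iota p iota_inj ip p_surj M3_quad; rewrite /FitMx.
  apply: (Fit_exact_quadratic (corner_map_exact ip) (corner_map_surj p_surj)).
  - exact: corner_map_inj.
  - exact: fp.
  - exact: corner_quadratic.
split.
  (* Both sides are computed from one matrix [H]: passing to blocks commutes with applying [f] to
     the entries. *)
  move=> S f; have [a [b [H MH]]] := fpM.
  rewrite /FitMx (Fit_presents (presents_corner _ MH)).
  rewrite (Fit_presents (presents_corner _ (presents_base_change f MH))).
  by rewrite -map_corner_rel minors_ideal_map.
split.
  rewrite /FitMx -(Fit_ffun n.+1 (fp _ fpM)).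
  have [g gK g'K] := corner_tuple_bij M ord0.
  symmetry; apply: (Fit_iso (g := mk_linear (can2_linear gK g'K))).
    have [a [b [h Nh]]] := fp M fpM.
    by have [a' [b' [h' [Nh' _]]]] := presents_ffun n.+1 Nh; exists a', b', h'.
  by exists (corner_tuple ord0).
move=> I [s Is]; have II := idealP I.
pose J := Ideal (scalar_ideal_ideal II); have IJ := matrix_idealE II.
exists J; split=> //.
  exists (quot_mx_rmorphism (J := J) IJ).
  by split; [exact: quot_mx_bij | exact: quot_mxE].
apply: (FitMx_quot (J := J) IJ); rewrite /fg_ideal /= Is.
by eexists; apply: scalar_ideal_fg.
Qed.
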